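(* Let $u_{1}$ and $u_{2}$ be weights on $\mathbb{R}^{n}$. Assume that $$0\leq\alpha<n,\quad 0<q\leq p<\infty,\quad 0<t\leq s<\infty,\quad \vec q=(q_1,q_2),\quad 0<r_{i}<q_{i}<\infty\ (i=1,2),$$ where $1/q=1/q_{1}+1/q_{2}$, and put $\vec R=(r_1,r_2)$. Suppose that $$\frac{1}{s}=\frac{1}{p}-\frac{\alpha}{n},\quad\frac{t}{s}=\frac{q}{p},$$ and that $$[u_{1},u_{2}]_{\vec{q}}^{s}:=\sup_{Q\in\mathcal{D}(\mathbb{R}^{n})}\left(\frac1{|Q|}\int_{Q}u_{1}^{\frac{s}{q_{1}}}u_{2}^{\frac{s}{q_{2}}}\right)^{\frac{1}{s}}\left(\frac1{|Q|}\int_{Q}u_{1}^{-\frac{r_{1}}{q_{1}-r_{1}}}\right)^{\frac{q_{1}-r_{1}}{r_{1}q_{1}}}\left(\frac1{|Q|}\int_{Q}u_{2}^{-\frac{r_{2}}{q_{2}-r_{2}}}\right)^{\frac{q_{2}-r_{2}}{r_{2}q_{2}}}<\infty.$$ Then $$\|M_{\alpha,\vec{R}}(f,g)u_{1}^{\frac{1}{q_{1}}}u_{2}^{\frac{1}{q_{2}}}\|_{\mathcal{M}_{t}^{s}}\leq C[u_{1},u_{2}]_{\vec{q}}^{s} \sup_{Q\in\mathcal{D}(\mathbb{R}^{n})}|Q|^{1/p}\left(\frac1{|Q|}\int_{Q}|f|^{q_{1}}u_{1}\right)^{1/q_{1}}\left(\frac1{|Q|}\int_{Q}|g|^{q_{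2}}u_{2}\right)^{1/q_{2}}.$$
   Context: $C$ denotes a constant independent of the essential variables (in particular of $f$ and $g$); $f,g$ are measurable functions on $\mathbb{R}^n$. ''Weight'' has its usual meaning (a nonnegative locally integrable function). $\mathcal{D}(\mathbb{R}^{n})=\{2^{-k}([0,1)^{n}+m):k\in\mathbb{Z},\,m\in\mathbb{Z}^{n}\}$ is the set of dyadic cubes. For $\vec R=(r_1,r_2)$, $$M_{\alpha,\vec{R}}(f,g)(x)=\sup_{\mathcal{D}(\mathbb{R}^{n})\ni Q\ni x}|Q|^{\frac{\alpha}{n}}\left(\frac1{|Q|}\int_{Q}|f|^{r_{1}}\right)^{\frac{1}{r_{1}}}\left(\frac1{|Q|}\int_{Q}|g|^{r_{2}}\right)^{\frac{1}{r_{2}}}.$$ For $0<t\le s<\infty$, $\|h\|_{\mathcal{M}_{t}^{s}}=\sup_{Q\in\mathcal{D}(\mathbb{R}^{n})}|Q|^{1/s}\left(\frac{1}{|Q|}\int_{Q}|h|^{t}\right)^{1/t}$.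
   Formalization: The constant C may depend on the weights u_1, u_2 (and the exponents and n), but not on f, g; with C independent of the weights the bound linear in [u_1,u_2] fails, e.g. for n=1, α=0, p=q=s=t, r_i=1, u_2=1, u_1=|x|^{(q_1-1)(1-d)} as d→0. *)

(* Defs.v *)
From HB Require Import structures.
From mathcomp Require Import all_boot all_order all_algebra.
From mathcomp Require Import all_classical all_reals all_analysis.

Set Implicit Arguments.
Unset Strict Implicit.
Unset Printing Implicit Defensive.
Import Order.TTheory GRing.Theory Num.Theory.
Import numFieldNormedType.Exports.

Local Open Scope classical_set_scope.
Local Open Scope ring_scope.

Section borel_lebesgue.
Local Open Scope ereal_scope.
Context {R : realType}.

Definition tcons n (x : R * n.-tuple R) : n.+1.-tuple R :=
  [tuple of x.1 :: x.2].

Lemma measurable_tcons n : measurable_fun [set: R * n.-tuple R] (@tcons n).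
Proof. exact: measurable_cons. Qed.

Section step.
Variables (n : nat) (mu : {sigma_finite_measure set (n.-tuple R) -> \bar R}).

Definition lebesgue_cons : set (n.+1.-tuple R) -> \bar R :=
  pushforward (@lebesgue_measure R \x mu) (@tcons n).

Let lebesgue_cons0 : lebesgue_cons set0 = 0.
Proof. by rewrite /lebesgue_cons /pushforward preimage_set0 measure0. Qed.

Let lebesgue_cons_ge0 A : 0 <= lebesgue_cons A.
Proof. exact: (measure_ge0 (@lebesgue_measure R \x mu)). Qed.

Let lebesgue_cons_sigma_additive : semi_sigma_additive lebesgue_cons.
Proof.
move=> F mF tF mUF; rewrite /lebesgue_cons /pushforward preimage_bigcup.
apply: measure_semi_sigma_additive.
- by move=> i; rewrite -[X in measurable X]setTI; exact: measurable_tcons.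
- apply/trivIsetP => i j _ _ ij; rewrite -preimage_setI.
  by move/trivIsetP : tF => ->//; rewrite preimage_set0.
- rewrite -preimage_bigcup -[X in measurable X]setTI.
  exact: measurable_tcons.
Qed.

HB.instance Definition _ := isMeasure.Build _ _ _ lebesgue_cons
  lebesgue_cons0 lebesgue_cons_ge0 lebesgue_cons_sigma_additive.

Let lebesgue_cons_sigma_finite : sigma_finite setT lebesgue_cons.
Proof.
have /sigma_finiteP[F [TF ndF Foo]] := sigma_finiteT (@lebesgue_measure R).
have /sigma_finiteP[G [TG ndG Goo]] := sigma_finiteT mu.
pose unc (y : n.+1.-tuple R) : R * n.-tuple R := (thead y, [tuple of behead y]).
have tconsK : cancel (@tcons n) unc.
  move=> [x t]; congr pair; exact/val_inj.
have uncK : cancel unc (@tcons n).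
  by move=> y; rewrite /tcons [RHS]tuple_eta.
have munc : measurable_fun [set: n.+1.-tuple R] unc.
  apply/measurable_fun_pairP; split; first exact: measurable_tnth.
  exact: measurable_behead.
exists (fun k => unc @^-1` (F k `*` G k)).
  rewrite -preimage_bigcup (_ : \bigcup_k _ = setT) ?preimage_setT//.
  apply/seteqP; split=> // -[x t] _.
  have [i _ Fix] : (\bigcup_k F k) x by rewrite -TF.
  have [j _ Gjt] : (\bigcup_k G k) t by rewrite -TG.
  exists (maxn i j) => //; split => /=.
    by move: x Fix; exact/subsetPset/ndF/leq_maxl.
  by move: t Gjt; exact/subsetPset/ndG/leq_maxr.
move=> k; have [mF Fkoo] := Foo k; have [mG Gkoo] := Goo k; split.
  by rewrite -[X in measurable X]setTI; apply: munc => //; exact: measurableX.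
rewrite /lebesgue_cons /pushforward -comp_preimage.
rewrite (_ : unc \o @tcons n = id) ?preimage_id; last exact/funext.
by rewrite product_measure1E// lte_mul_pinfty// ge0_fin_numE.
Qed.

HB.instance Definition _ := Measure_isSigmaFinite.Build _ _ _ lebesgue_cons
  lebesgue_cons_sigma_finite.

End step.

(* n-dimensional Lebesgue measure on Borel sets, as an iterated product. *)
Fixpoint borel_lebesgue n : {sigma_finite_measure set (n.-tuple R) -> \bar R} :=
  match n with
  | 0 => \d_([tuple] : 0.-tuple R)
  | n'.+1 => lebesgue_cons (borel_lebesgue n')
  end.

Lemma borel_lebesgue_box n (A : 'I_n -> set R) :
  (forall i, measurable (A i)) ->
  measurable [set t : n.-tuple R | forall i, A i (tnth t i)] /\
  borel_lebesgue n [set t : n.-tuple R | forall i, A i (tnth t i)] =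
  \prod_(i < n) lebesgue_measure (A i).
Proof.
elim: n A => [|n IH] A mA.
  rewrite (_ : [set _ | _] = setT) ?big_ord0; last by apply/seteqP; split=> // t _ [].
  by split => //=; rewrite diracT.
have [mB volB] := IH (fun i => A (lift ord0 i)) (fun i => mA _).
have boxE : @tcons n @^-1` [set t | forall i, A i (tnth t i)] =
    A ord0 `*` [set t | forall i, A (lift ord0 i) (tnth t i)].
  apply/seteqP; split=> [[x t]/= At|[x t]/= [Ax At] i].
    split=> [|i]; first by have := At ord0; rewrite tnth0.
    by have := At (lift ord0 i); rewrite tnthS.
  have [->|] := eqVneq i ord0; first by rewrite tnth0.
  by case: (unliftP ord0 i) => [j ->|->]; rewrite ?eqxx// tnthS.
split.
  rewrite (_ : [set _ | _] = \big[setI/setT]_(i < n.+1) (@tnth _ R ^~ i @^-1` A i)).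
    apply: bigsetI_measurable => i _; rewrite -[X in measurable X]setTI.
    exact: measurable_tnth.
  apply/seteqP; split=> t /=; rewrite -bigcap_seq/=.
    by move=> At i _; exact: At.
  by move=> At i; apply: (At i); rewrite /= mem_index_enum.
rewrite /= /lebesgue_cons /pushforward boxE product_measure1E ?volB ?big_ord_recl//; exact: mA.
Qed.

End borel_lebesgue.

(* R^n with the (complete) sigma-algebra of Lebesgue measurable sets, obtained
   as the Caratheodory sets of the outer measure of borel_lebesgue. *)
Definition Rn (R : realType) (n : nat) : Type :=
  caratheodory_type ((@borel_lebesgue R n)^*)%mu.

HB.instance Definition _ (R : realType) (n : nat) := Measurable.on (Rn R n).

Section statement_notions.
Context {R : realType} {n : nat}.
Local Notation Rn := (Rn R n).
Local Open Scope ereal_scope.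

Definition coord (x : Rn) (i : 'I_n) : R := tnth (x : n.-tuple R) i.

Definition lebesgue : set Rn -> \bar R :=
  @completed_measure_extension _ _ R (borel_lebesgue n).

HB.instance Definition _ := Measure.on lebesgue.

Let lebesgue_sigma_finite : sigma_finite setT lebesgue.
Proof. exact/completed_measure_extension_sigma_finite/sigma_finiteT. Qed.

HB.instance Definition _ := Measure_isSigmaFinite.Build _ _ _ lebesgue
  lebesgue_sigma_finite.

(* The topology of R^n is the one of 'rV[R]_n. *)
Definition weight (u : Rn -> R) : Prop :=
  [/\ measurable_fun [set: Rn] u,
      (forall x, (0 <= u x)%R) &
      forall K : set 'rV[R]_n, compact K ->
        \int[lebesgue]_(x in [set x | K (\row_i coord x i)]) (u x)%:E < +oo].

(* The cube 2^-k ([0, 1)^n + m). *)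
Definition dyadic_cube (k : int) (m : 'I_n -> int) : set Rn :=
  [set x | forall i,
    ((2 : R) ^ (- k) * (m i)%:~R <= coord x i < 2 ^ (- k) * ((m i)%:~R + 1))%R].

Definition dyadic : set (set Rn) := [set Q | exists k m, Q = dyadic_cube k m].

Lemma lebesgue_dyadic_cube k m :
  measurable (dyadic_cube k m) /\
  lebesgue (dyadic_cube k m) = (((2 : R) ^ (- k)) ^+ n)%:E.
Proof.
pose a (i : 'I_n) := ((2 : R) ^ (- k) * (m i)%:~R)%R.
pose b (i : 'I_n) := ((2 : R) ^ (- k) * ((m i)%:~R + 1))%R.
have [mQ volQ] := @borel_lebesgue_box R n (fun i => [set` `[a i, b i[])
  (fun i => measurable_itv _).
have QE : dyadic_cube k m =
    [set t : n.-tuple R | forall i, [set` `[a i, b i[] (tnth t i)].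
  by apply/seteqP; split=> x Qx i; have := Qx i; rewrite /= in_itv.
have ab i : (b i - a i = (2 : R) ^ (- k))%R.
  by rewrite /a /b mulrDr mulr1 addrAC subrr add0r.
rewrite QE; split; first exact: caratheodory_measurable_mu_ext.
apply: etrans (measurable_mu_extE _ mQ) _; apply: etrans volQ _.
under eq_bigr => i _.
  rewrite lebesgue_measure_itv/= lte_fin -subr_gt0 ab exprz_gt0// -EFinB ab.
  over.
by rewrite prodEFin prodr_const card_ord.
Qed.

Definition avg (Q : set Rn) (F : Rn -> \bar R) : \bar R :=
  (lebesgue Q)^-1 * \int[lebesgue]_(x in Q) F x.

Definition maximal (alpha r1 r2 : R) (f g : Rn -> R) (x : Rn) : \bar R :=
  ereal_sup [set lebesgue Q `^ (alpha / n%:R)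
      * avg Q (fun y => (`|f y| `^ r1)%:E) `^ r1^-1
      * avg Q (fun y => (`|g y| `^ r2)%:E) `^ r2^-1
    | Q in [set Q | dyadic Q /\ Q x]].

Definition morrey_norm (t s : R) (h : Rn -> \bar R) : \bar R :=
  ereal_sup [set lebesgue Q `^ s^-1 * avg Q (fun x => `|h x| `^ t) `^ t^-1
    | Q in dyadic].

(* u^-a for 0 < a, with 0^-a = +oo; the real 0 `^ (- a) is 0. *)
Definition neg_power (u : Rn -> R) (a : R) (x : Rn) : \bar R :=
  (u x `^ a)%:E^-1.

(* Products of extended reals follow the convention 0 * +oo = 0. *)
Definition weight_const (s q1 q2 r1 r2 : R) (u1 u2 : Rn -> R) : \bar R :=
  ereal_sup [set
      avg Q (fun x => (u1 x `^ (s / q1) * u2 x `^ (s / q2))%:E) `^ s^-1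
      * avg Q (neg_power u1 (r1 / (q1 - r1))) `^ ((q1 - r1) / (r1 * q1))
      * avg Q (neg_power u2 (r2 / (q2 - r2))) `^ ((q2 - r2) / (r2 * q2))
    | Q in dyadic].

Definition weighted_morrey_product (p q1 q2 : R) (u1 u2 f g : Rn -> R) :
    \bar R :=
  ereal_sup [set lebesgue Q `^ p^-1
      * avg Q (fun x => (`|f x| `^ q1 * u1 x)%:E) `^ q1^-1
      * avg Q (fun x => (`|g x| `^ q2 * u2 x)%:E) `^ q2^-1
    | Q in dyadic].

End statement_notions.

(* Main.v *)
Require Import Defs.
From HB Require Import structures.
From mathcomp Require Import all_boot all_order all_algebra.
From mathcomp Require Import all_classical all_reals all_analysis.
From mathcomp Require Import measurable_realfun ring lra.

Set Implicit Arguments.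
Unset Strict Implicit.
Unset Printing Implicit Defensive.

Import Order.TTheory GRing.Theory Num.Theory.
Import numFieldNormedType.Exports.
Local Open Scope classical_set_scope.
Local Open Scope ring_scope.

(** Write v = u1^(s/q1) u2^(s/q2), sigma_i = u_i^(-r_i/(q_i-r_i)) and
    d_i = 1/r_i - 1/q_i, let K be the testing constant [u1,u2] and N the Morrey
    quantity of (f, g) on the right-hand side, and fix a dyadic cube Q0.  For a
    dyadic cube Q let c_Q be the term of Q in the supremum defining the maximal
    function.

    Hölder's inequality gives int_Q |f|^r1 <=
    (int_Q |f|^q1 u1)^(r1/q1) sigma_1(Q)^(1-r1/q1), and likewise for g.
    Inserting this in c_Q and using the testing condition and
    1/s = 1/p - alpha/n yields c_Q v(Q)^(1/s) <= K N.  Hence the cubes Q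
    containing Q0 contribute at most the constant K N v(Q0)^(-1/s) on Q0, which
    is the required bound because t <= s (large_cube_term).

    For the cubes inside Q0, run a stopping time: a subcube is a stopping cube
    when the average of |f|^r1 or that of |g|^r2 exceeds four times its value on
    the previous stopping cube.  Up to a constant, c_Q is at most c_P for the
    stopping cube P above Q (fractional_average_ancestor), so it suffices to sum
    c_P^t int_P v^(t/s) over the stopping cubes.  With
    A_i(P) = sigma_i(P) (int_P |f_i|^r_i / sigma_i(P))^(q_i/r_i), the testing
    condition and t/s = q/p bound each term by
    K^t N^(t-q) A_1(P)^(q/q1) A_2(P)^(q/q2) (fractional_average_term), and by
    Young's inequality it remains to see that sum_P A_i(P) is at most a constant
    times int_Q0 |f_i|^q_i u_i.  That is a Carleson embedding for sigma_i
    (carleson_embedding): it holds as soon as the part of P covered by no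
    smaller stopping cube carries a fixed fraction of sigma_i(P).  For Lebesgue
    measure the fraction is one half by the choice of the stopping cubes
    (stopping_sparse), and the testing condition together with
    |E| <= v(E)^a sigma_1(E)^b1 sigma_2(E)^b2, where a + b1 + b2 = 1, transfers
    this to sigma_i, an A_infinity property (unstopped_mass_A_infty).  The
    fraction, hence the final constant, depends on K.

    The argument for small cubes only involves additive set functions on the
    2^n-ary tree of dyadic subcubes of Q0, so it is carried out for arbitrary
    additive functions on a tree, truncated at a finite depth; the truncation
    is removed by monotone convergence. *)

(** * Inequalities between powers *)

Section powR_inequalities.
Context {R : realType}.
Implicit Types a b c x y z u w X Y Z : R.

Lemma powR_expR x a : 0 < x -> x `^ a = expR (a * ln x).
Proof. by move=> x0; rewrite /powR gt_eqF. Qed.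

Lemma ln_le_sub1 x : 0 < x -> ln x <= x - 1.
Proof.
move=> x0; have := expR_ge1Dx (ln x); rewrite lnK ?posrE//; lra.
Qed.

(** Unlike the bound through ln, this one also covers x = 0; multiplying such
    bounds gives the weighted arithmetic-geometric mean inequality. *)
Lemma powR_le_expR x a : 0 <= x -> 0 <= a -> x `^ a <= expR (a * (x - 1)).
Proof.
rewrite le_eqVlt => /predU1P[<-|x0] a0.
  have [->|an0] := eqVneq a 0; first by rewrite powRr0 mul0r expR0.
  by rewrite powR0// expR_ge0.
by rewrite powR_expR// ler_expR ler_wpM2l// ln_le_sub1.
Qed.

Lemma weighted_amgm3 a b c x y z : 0 <= a -> 0 <= b -> 0 <= c ->
  a + b + c = 1 -> 0 <= x -> 0 <= y -> 0 <= z ->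
  x `^ a * y `^ b * z `^ c <= a * x + b * y + c * z.
Proof.
move=> a0 b0 c0 abc x0 y0 z0.
set A := a * x + b * y + c * z.
have [ax0 by0 cz0] : [/\ 0 <= a * x, 0 <= b * y & 0 <= c * z].
  by rewrite !mulr_ge0.
have [A0|] := ltP 0 A; last first.
  move=> A0.
  have [ax by_ cz] : [/\ a * x = 0, b * y = 0 & c * z = 0].
    by split; rewrite /A in A0; lra.
  suff -> : x `^ a * y `^ b * z `^ c = 0 by rewrite /A ax by_ cz !addr0.
  have : (a != 0) || (b != 0) || (c != 0).
    apply/negP => /negP; rewrite !negb_or !negbK.
    by move=> /andP[/andP[/eqP ? /eqP ?]/eqP ?]; lra.
  have zero u w : u * w = 0 -> u != 0 -> w `^ u = 0.
    by move=> /eqP; rewrite mulf_eq0 => /orP[->//|/eqP -> u0]; rewrite powR0.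
  move=> /orP[/orP[n0|n0]|n0].
  - by rewrite (zero a)// !mul0r.
  - by rewrite (zero b)// mulr0 mul0r.
  - by rewrite (zero c)// mulr0.
have An0 : A != 0 by rewrite gt_eqF.
have scale u e : 0 <= u -> u `^ e = A `^ e * (u / A) `^ e.
  by move=> u0; rewrite -powRM ?divr_ge0 ?(ltW A0)// mulrC divfK.
have -> : x `^ a * y `^ b * z `^ c =
    A * ((x / A) `^ a * (y / A) `^ b * (z / A) `^ c).
  rewrite (scale x a)// (scale y b)// (scale z c)//.
  have AE : A `^ a * A `^ b * A `^ c = A.
    by rewrite -!powRD ?An0 ?implybT// abc powRr1 ?(ltW A0).
  rewrite -[X in _ = X * _]AE; ring.
rewrite -[leRHS]mulr1 ler_wpM2l ?(ltW A0)//.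
apply: (@le_trans _ _ (expR (a * (x / A - 1)) * expR (b * (y / A - 1))
                       * expR (c * (z / A - 1)))).
  have div0 u : 0 <= u -> 0 <= u / A by move=> u0; rewrite divr_ge0 ?(ltW A0).
  by rewrite !ler_pM ?mulr_ge0 ?powR_ge0 ?powR_le_expR ?div0.
rewrite -!expRD (_ : _ + _ = 0) ?expR0//.
rewrite [LHS](_ : _ = A / A - (a + b + c)); last by rewrite {4}/A; ring.
by rewrite divff// abc subrr.
Qed.

(** Summing or integrating this inequality with X, Y, Z the totals of x, y, z
    gives Hölder's inequality with three factors. *)
Lemma weighted_amgm3_scaled a b c x y z X Y Z : 0 <= a -> 0 <= b -> 0 <= c ->
  a + b + c = 1 -> 0 <= x -> 0 <= y -> 0 <= z -> 0 < X -> 0 < Y -> 0 < Z ->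
  x `^ a * y `^ b * z `^ c <=
  X `^ a * Y `^ b * Z `^ c * (a / X * x + b / Y * y + c / Z * z).
Proof.
move=> a0 b0 c0 abc x0 y0 z0 X0 Y0 Z0.
have E u U e : 0 <= u -> 0 < U -> u `^ e = U `^ e * (u / U) `^ e.
  move=> u0 U0; rewrite -powRM ?divr_ge0 ?(ltW U0)//.
  by rewrite mulrC divfK ?gt_eqF.
rewrite (E x X)// (E y Y)// (E z Z)//.
rewrite [leLHS](_ : _ = X `^ a * Y `^ b * Z `^ c *
  ((x / X) `^ a * (y / Y) `^ b * (z / Z) `^ c)); last by ring.
rewrite ler_wpM2l ?mulr_ge0 ?powR_ge0//.
apply: le_trans (weighted_amgm3 a0 b0 c0 abc _ _ _) _;
  rewrite ?divr_ge0 ?(ltW X0) ?(ltW Y0) ?(ltW Z0)//.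
by rewrite le_eqVlt; apply/orP; left; apply/eqP; ring.
Qed.

Lemma sum_holder3 (I : finType) (a b c : R) (x y z : I -> R) :
  0 < a -> 0 < b -> 0 < c -> a + b + c = 1 ->
  (forall i, 0 <= x i) -> (forall i, 0 <= y i) -> (forall i, 0 <= z i) ->
  \sum_i (x i `^ a * y i `^ b * z i `^ c) <=
  (\sum_i x i) `^ a * (\sum_i y i) `^ b * (\sum_i z i) `^ c.
Proof.
move=> a0 b0 c0 abc x0 y0 z0.
have zero (u : I -> R) e : 0 < e -> (forall i, 0 <= u i) ->
    ~~ (0 < \sum_i u i) -> forall i, u i `^ e = 0.
  move=> e0 u0; rewrite lt_neqAle sumr_ge0// andbT negbK eq_sym => /eqP s0 i.
  have /psumr_eq0P : forall i, true -> 0 <= u i by [].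
  by move=> /(_ s0 i isT) ->; rewrite powR0 ?gt_eqF.
have R0 : 0 <= (\sum_i x i) `^ a * (\sum_i y i) `^ b * (\sum_i z i) `^ c.
  by rewrite !mulr_ge0 ?powR_ge0.
have [X0|/negP/negP X0] := boolP (0 < \sum_i x i); last first.
  by rewrite big1// => i _; rewrite (zero x a)// !mul0r.
have [Y0|/negP/negP Y0] := boolP (0 < \sum_i y i); last first.
  by rewrite big1// => i _; rewrite (zero y b)// mulr0 mul0r.
have [Z0|/negP/negP Z0] := boolP (0 < \sum_i z i); last first.
  by rewrite big1// => i _; rewrite (zero z c)// mulr0.
apply: (@le_trans _ _ (\sum_i ((\sum_i x i) `^ a * (\sum_i y i) `^ b *
    (\sum_i z i) `^ c * (a / (\sum_i x i) * x i + b / (\sum_i y i) * y i +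
    c / (\sum_i z i) * z i)))).
  by apply: ler_sum => i _; apply: weighted_amgm3_scaled => //; exact: ltW.
rewrite -mulr_sumr !big_split/= -!mulr_sumr !divfK ?gt_eqF// abc mulr1//.
Qed.

(** The tangent plane of the convex, 1-homogeneous function
    (x, w) |-> x^r w^(1-r) along the ray x = l w lies below it. *)
Lemma young_tangent (r l x w : R) : 1 < r -> 0 <= l -> 0 <= x -> 0 < w ->
  r * l `^ (r - 1) * x <= x `^ r * w `^ (1 - r) + (r - 1) * (l `^ r * w).
Proof.
move=> r1 l0 x0 w0.
have r0 : 0 < r by lra.
have i0 : 0 <= r^-1 by rewrite invr_ge0 ltW.
have := @weighted_amgm3 r^-1 (1 - r^-1) 0 (x `^ r * w `^ (1 - r)) (l `^ r * w) 0.
rewrite powRr0 mulr1 mul0r addr0 => H.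
have i1 : 0 <= 1 - r^-1 by rewrite subr_ge0 invf_le1// ltW.
have {H} := H i0 i1 (lexx _).
rewrite addr0 subrKC => /(_ erefl).
rewrite !mulr_ge0 ?powR_ge0 ?(ltW w0)// => /(_ isT isT (lexx _)).
rewrite !powRM ?powR_ge0 ?(ltW w0)// -!powRrM divff ?gt_eqF// powRr1//.
rewrite (_ : r * (1 - r^-1) = r - 1); last by rewrite mulrBr mulr1 divff ?gt_eqF.
rewrite mulrACA -powRD ?(gt_eqF w0) ?implybT//.
rewrite (_ : (1 - r) / r + (1 - r^-1) = 0); last by field; rewrite gt_eqF.
rewrite powRr0 mulr1 -(ler_pM2l r0) mulrDr !mulrA divff ?gt_eqF// mul1r.
by rewrite mulrBr mulr1 divff ?gt_eqF// -!mulrA [_ * x]mulrC.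
Qed.

(** The Bellman function H^r W^(1-r) decreases when W grows; its decrease over
    an increment D >= eta s pays for one term of the Carleson sum. *)
Lemma bellman_step (r eta H s W D : R) (f : bool) :
  1 < r -> 0 <= eta -> 0 <= H -> 0 < s -> s <= W ->
  f%:R * (eta * s) <= D -> W + D <= 2 * s ->
  eta * ((r - 1) * 2 `^ (- r)) * (f%:R * (s * (H / s) `^ r)) +
    H `^ r * (W + D) `^ (1 - r) <= H `^ r * W `^ (1 - r).
Proof.
move=> r1 eta0 H0 s0 sW etaD WD2.
have W0 : 0 < W by exact: lt_le_trans sW.
have D0 : 0 <= D by apply: le_trans etaD; rewrite !mulr_ge0 ?(ltW s0).
have U0 : 0 < W + D by rewrite ltr_pwDl.
have convex : (W + D) `^ (1 - r) + (r - 1) * D * (W + D) `^ (- r) <= W `^ (1 - r).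
  rewrite (powRD (x := W + D)) ?(gt_eqF U0) ?implybT// powRr1 ?(ltW U0)//.
  rewrite -mulrDl.
  have -> : W `^ (1 - r) = W * (W / (W + D)) `^ (- r) * (W + D) `^ (- r).
    rewrite -mulrA -powRM ?divr_ge0 ?(ltW W0) ?(ltW U0)// divfK ?gt_eqF//.
    by rewrite powRD ?(gt_eqF W0) ?implybT// powRr1 ?(ltW W0).
  rewrite ler_wpM2r ?powR_ge0//.
  have R0 : 0 < W / (W + D) by rewrite divr_gt0.
  have : 1 + (r - 1) * D / (W + D) <= (W / (W + D)) `^ (1 - r).
    rewrite powR_expR//; apply: le_trans (expR_ge1Dx _); rewrite lerD2l.
    have := ln_le_sub1 R0.
    rewrite (_ : W / (W + D) - 1 = - (D / (W + D))); last first.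
      by field; rewrite gt_eqF.
    move=> h; rewrite -mulrA -[1 - r]opprB mulNr -mulrN ler_wpM2l//; lra.
  rewrite (powRD (x := W / (W + D))) ?(gt_eqF R0) ?implybT// powRr1 ?(ltW R0)//.
  move=> /(ler_wpM2l (ltW U0)).
  rewrite (_ : _ * (1 + _) = W + D + (r - 1) * D); last by field; rewrite gt_eqF.
  rewrite (_ : (W + D) * (W / (W + D) * _) = W * (W / (W + D)) `^ (- r)) //.
  by field; rewrite gt_eqF.
have H0r : 0 <= H `^ r by exact: powR_ge0.
apply: le_trans (ler_wpM2l H0r convex); rewrite mulrDr addrC lerD2l.
rewrite powRM ?invr_ge0 ?(ltW s0)//.
have -> : s^-1 `^ r = s `^ (- r).
  by rewrite powRN -powRN -powR_inv1 ?(ltW s0)// -powRrM mulN1r.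
rewrite [leLHS](_ : _ = H `^ r *
  ((r - 1) * (f%:R * (eta * s)) * (2 `^ (- r) * s `^ (- r)))); last by ring.
rewrite ler_wpM2l// ler_pM ?mulr_ge0 ?powR_ge0 ?(ltW s0) ?subr_ge0 ?(ltW r1)//.
  by rewrite ler_wpM2l// subr_ge0 ltW.
rewrite -powRM ?(ltW s0)// !powRN lef_pV2 ?posrE ?powR_gt0 ?mulr_gt0//.
by rewrite ge0_ler_powR ?nnegrE ?mulr_ge0 ?(ltW s0) ?(ltW U0)//; lra.
Qed.

(** Hölder's inequality for the average of |f|^r, solved for the integral J of
    |f|^q u. *)
Lemma holder_solve (r q X S J : R) : 0 < r -> r < q -> 0 <= X -> 0 < S -> 0 < J ->
  X <= J `^ (r / q) * S `^ (1 - r / q) -> X `^ (q / r) * S `^ (1 - q / r) <= J.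
Proof.
move=> r0 rq X0 S0 J0 h; have q0 := lt_trans r0 rq.
have qr0 : 0 < q / r by rewrite divr_gt0.
have /(ge0_ler_powR (ltW qr0)) := h.
rewrite !nnegrE X0 mulr_ge0 ?powR_ge0// => /(_ isT isT).
rewrite powRM ?powR_ge0// -!powRrM.
have -> : r / q * (q / r) = 1 by field; rewrite !gt_eqF.
rewrite powRr1 ?(ltW J0)//.
move=> /(ler_wpM2r (powR_ge0 S (1 - q / r))) /le_trans; apply.
rewrite -mulrA -powRD ?(gt_eqF S0) ?implybT//.
rewrite (_ : (1 - r / q) * (q / r) + (1 - q / r) = 0) ?powRr0 ?mulr1//.
by field; rewrite !gt_eqF.
Qed.

Lemma average_product_le (V S1 S2 c K a b e : R) : 0 < c -> 0 <= V -> 0 <= S1 ->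
  0 <= S2 -> (V / c) `^ a * (S1 / c) `^ b * (S2 / c) `^ e <= K ->
  V `^ a * S1 `^ b * S2 `^ e <= K * c `^ (a + b + e).
Proof.
move=> c0 V0 S10 S20 h.
have E I x : 0 <= I -> I `^ x = (I / c) `^ x * c `^ x.
  by move=> I0; rewrite -powRM ?divr_ge0 ?(ltW c0)// divfK ?gt_eqF.
rewrite (E V a)// (E S1 b)// (E S2 e)// !(@powRD _ c) ?(gt_eqF c0) ?implybT//.
rewrite [leLHS](_ : _ = (V / c) `^ a * (S1 / c) `^ b * (S2 / c) `^ e *
  (c `^ a * c `^ b * c `^ e)); last by ring.
by rewrite ler_wpM2r// !mulr_ge0 ?powR_ge0.
Qed.

(** The quantity A_i(P) of a cube, in the two forms that are used. *)
Lemma energyE (r X sg : R) : 0 < sg -> 0 <= X ->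
  sg * (X / sg) `^ r = X `^ r * sg `^ (1 - r).
Proof.
move=> sg0 X0; rewrite powRM ?invr_ge0 ?(ltW sg0)// powRD ?(gt_eqF sg0) ?implybT//.
rewrite powRr1 ?(ltW sg0)// -[sg^-1]powR_inv1 ?(ltW sg0)// -powRrM mulN1r.
by rewrite mulrCA.
Qed.

(** The power of the volume c in the local estimate is the one that the Morrey
    norm cancels. *)
Lemma morrey_normalization (c A B s t : R) : 0 < c -> 0 <= A -> 0 <= B ->
  0 < t -> 0 < s ->
  c `^ s^-1 * (c^-1 * (A * B `^ t * c `^ (1 - t / s))) `^ t^-1 = A `^ t^-1 * B.
Proof.
move=> c0 A0 B0 t0 s0.
have -> : c^-1 * (A * B `^ t * c `^ (1 - t / s)) = A * B `^ t * c `^ (- (t / s)).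
  rewrite powRD ?(gt_eqF c0) ?implybT// powRr1 ?(ltW c0)//.
  by field; rewrite gt_eqF.
rewrite powRM; [|by rewrite mulr_ge0 ?powR_ge0|exact: powR_ge0].
rewrite powRM; [|exact: A0|exact: powR_ge0].
rewrite -!powRrM divff ?gt_eqF// powRr1//.
have cc : c `^ s^-1 * c `^ (- (t / s) / t) = 1.
  rewrite -powRD ?(gt_eqF c0) ?implybT// (_ : _ + _ = 0) ?powRr0//.
  by field; rewrite !gt_eqF.
by rewrite mulrCA cc mulr1.
Qed.

(** The exponent 1/r - 1/u of the dual weights in the testing condition. *)
Definition dual_exponent (r u : R) := r^-1 - u^-1.

Lemma dual_exponentE (r q : R) : 0 < r -> r < q ->
  (q - r) / (r * q) = dual_exponent r q.
Proof.
move=> r0 rq; rewrite /dual_exponent; field.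
by rewrite !gt_eqF// (lt_trans r0).
Qed.

Lemma dual_exponent_gt0 (r q : R) : 0 < r -> r < q -> 0 < dual_exponent r q.
Proof.
by move=> r0 rq; rewrite subr_gt0 ltf_pV2 ?posrE// (lt_trans r0).
Qed.

End powR_inequalities.

(** * Stopping nodes on a tree *)

Section tree.
Context {R : realType} {B : finType}.
Implicit Types (w v : seq B) (phi : seq B -> R).

(** The nodes of the tree are words over B; the children of w are the words
    b :: w.  These are the descendants of w, w included, at depth at most N
    below w. *)
Fixpoint descendants (N : nat) (w : seq B) : seq (seq B) :=
  if N is N'.+1 then w :: flatten [seq descendants N' (b :: w) | b <- enum B]
  else [:: w].

Lemma sum_descendants N w phi :
  \sum_(v <- descendants N.+1 w) phi v =
  phi w + \sum_b \sum_(v <- descendants N (b :: w)) phi v.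
Proof. by rewrite /= big_cons big_flatten/= big_map big_enum. Qed.

Lemma sum_descendants_le N phi w : (forall v, 0 <= phi v) ->
  \sum_(v <- descendants N w) phi v <= \sum_(v <- descendants N.+1 w) phi v.
Proof.
move=> phi0; elim: N w => [|N IH] w.
  rewrite sum_descendants /= big_seq1 lerDl.
  by apply: sumr_ge0 => b _; apply: sumr_ge0.
rewrite (sum_descendants N) (sum_descendants N.+1) lerD2l.
by apply: ler_sum => b _; exact: IH.
Qed.

Lemma sum_descendants_homo phi w : (forall v, 0 <= phi v) ->
  {homo (fun N => \sum_(v <- descendants N w) phi v) : N M / (N <= M)%N >-> N <= M}.
Proof.
move=> phi0; apply: homo_leq => [x|x y z|N]; [exact: lexx|exact: le_trans|].
exact: sum_descendants_le.
Qed.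

Lemma le_sum_descendants phi v w : (forall u, 0 <= phi u) ->
  phi (v ++ w) <= \sum_(u <- descendants (size v) w) phi u.
Proof.
move=> phi0; elim/last_ind: v w => [|v b IH] w; first by rewrite /= big_seq1.
rewrite size_rcons sum_descendants cat_rcons; apply: (le_trans (IH (b :: w))).
rewrite (bigD1 b)//= addrCA lerDl addr_ge0// sumr_ge0// => e _.
by apply: sumr_ge0.
Qed.

(** The values of a set function on the cubes of the tree. *)
Definition tree_additive phi := forall w, phi w = \sum_b phi (b :: w).

Section stopping.
Variables m X1 X2 : seq B -> R.

(** With m(w) the volume of the node w and X_i(w) the integral of the i-th
    function over it, w jumps with respect to an ancestor p when one of the
    averages X_i/m is more than four times larger at w than at p.  Nodes where
    some X_i vanishes never jump, so that both X_i are positive at every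
    stopping node below the root. *)
Definition jump (p w : seq B) : bool := (0 < X1 w * X2 w) &&
  ((4 * X1 p * m w < X1 w * m p) || (4 * X2 p * m w < X2 w * m p)).

(** The closest stopping node at or above w; the root is a stopping node. *)
Fixpoint stopping_ancestor (w : seq B) : seq B :=
  if w is b :: w' then
    if jump (stopping_ancestor w') w then w else stopping_ancestor w'
  else [::].

(** A node is a stopping node when it jumps with respect to the stopping
    ancestor of its parent. *)
Definition stopping (w : seq B) : bool :=
  if w is b :: w' then jump (stopping_ancestor w') w else true.

Lemma stopping_ancestor_id w : stopping w -> stopping_ancestor w = w.
Proof. by case: w => //= b w ->. Qed.

Lemma stopping_ancestor_cons b w : ~~ stopping (b :: w) ->
  stopping_ancestor (b :: w) = stopping_ancestor w.
Proof. by move=> /= /negbTE ->. Qed.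

Lemma stopping_stopping_ancestor w : stopping (stopping_ancestor w).
Proof. by elim: w => //= b w IH; case: ifPn. Qed.

(** The phi-mass of the part of w covered by no stopping node strictly below w,
    up to depth N. *)
Fixpoint unstopped_mass (N : nat) phi (w : seq B) : R :=
  if N is N'.+1 then
    \sum_b (if stopping (b :: w) then 0 else unstopped_mass N' phi (b :: w))
  else phi w.

(** The sum of these masses over the stopping nodes at or below w.  The parts
    are disjoint, so the sum is at most phi(w). *)
Fixpoint stopped_mass (N : nat) phi (w : seq B) : R :=
  (stopping w)%:R * unstopped_mass N phi w +
  (if N is N'.+1 then \sum_b stopped_mass N' phi (b :: w) else 0).

Lemma stopped_massS N phi w : stopped_mass N.+1 phi w =
  (stopping w)%:R * unstopped_mass N.+1 phi w + \sum_b stopped_mass N phi (b :: w).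
Proof. by []. Qed.

Lemma unstopped_mass_ge0 N phi w : (forall v, 0 <= phi v) ->
  0 <= unstopped_mass N phi w.
Proof.
move=> phi0; elim: N w => //= N IH w.
by apply: sumr_ge0 => b _; case: ifP.
Qed.

Lemma unstopped_mass_le N phi w : (forall v, 0 <= phi v) ->
  tree_additive phi -> unstopped_mass N phi w <= phi w.
Proof.
move=> phi0 phiD; elim: N w => //= N IH w.
by rewrite [leRHS]phiD ler_sum// => b _; case: ifP.
Qed.

Lemma stopped_mass_ge0 N phi w : (forall v, 0 <= phi v) ->
  0 <= stopped_mass N phi w.
Proof.
move=> phi0; elim: N w => [|N IH] w; first by rewrite /= addr0 mulr_ge0.
rewrite stopped_massS addr_ge0//; last exact: sumr_ge0.
by rewrite mulr_ge0//; exact: unstopped_mass_ge0.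
Qed.

Lemma stopped_massE N phi w : tree_additive phi ->
  stopped_mass N phi w + (~~ stopping w)%:R * unstopped_mass N phi w = phi w.
Proof.
move=> phiD; elim: N w => [|N IH] w.
  by rewrite /= addr0 -mulrDl; case: stopping; rewrite /= ?addr0 ?add0r mul1r.
rewrite stopped_massS addrAC -mulrDl.
rewrite -natrD (_ : (_ + _)%N = 1%N); last by case: stopping.
rewrite mul1r /= -big_split/= [RHS]phiD; apply: eq_bigr => b _.
rewrite -[RHS]IH addrC -/(stopping (b :: w)).
by congr (_ + _); case: ifP => _; rewrite /= ?mul0r ?mul1r.
Qed.

Lemma stopped_mass_le N phi w : (forall v, 0 <= phi v) ->
  tree_additive phi -> stopped_mass N phi w <= phi w.
Proof.
move=> phi0 phiD; rewrite -[leRHS](stopped_massE N w phiD) lerDl.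
by rewrite mulr_ge0 ?unstopped_mass_ge0.
Qed.

Hypotheses (m0 : forall w, 0 < m w) (X10 : forall w, 0 <= X1 w)
  (X20 : forall w, 0 <= X2 w) (mD : tree_additive m)
  (X1D : tree_additive X1) (X2D : tree_additive X2)
  (X1nil : 0 < X1 [::]) (X2nil : 0 < X2 [::]).

Lemma stopping_gt0 w : stopping w -> 0 < X1 w /\ 0 < X2 w.
Proof.
case: w => //= b w /andP[xx _].
split; rewrite lt_neqAle ?X10 ?X20 andbT eq_sym; apply: contraTneq xx => ->.
  by rewrite mul0r ltxx.
by rewrite mulr0 ltxx.
Qed.

Lemma stopping_ancestor_average w : 0 < X1 w * X2 w ->
  X1 w * m (stopping_ancestor w) <= 4 * X1 (stopping_ancestor w) * m w /\
  X2 w * m (stopping_ancestor w) <= 4 * X2 (stopping_ancestor w) * m w.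
Proof.
move=> XX.
have [st|] := boolP (stopping w).
  rewrite stopping_ancestor_id//.
  have [A C] : 0 <= X1 w * m w /\ 0 <= X2 w * m w.
    by rewrite !mulr_ge0 ?(ltW (m0 w)).
  by split; lra.
case: w XX => // b w XX ns; rewrite stopping_ancestor_cons//.
by move: ns; rewrite /stopping /jump XX/= negb_or -!leNgt => /andP[].
Qed.

(** A first jump below w occupies at most a quarter of the volume for each of
    the two functions; cleared of denominators, relative to the stopping
    ancestor of w, this passes from the children to the parent. *)
Lemma unstopped_mass_ancestor N w :
  4 * X1 (stopping_ancestor w) * X2 (stopping_ancestor w) *
    (m w - unstopped_mass N m w) <=
  m (stopping_ancestor w) *
    (X2 (stopping_ancestor w) * X1 w + X1 (stopping_ancestor w) * X2 w).
Proof.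
elim: N w => [|N IH] w.
  by rewrite /= subrr mulr0 !mulr_ge0 ?addr_ge0 ?mulr_ge0 ?(ltW (m0 _)).
set p := stopping_ancestor w.
rewrite [unstopped_mass _ _ _]/= [X in X - _]mD -sumrB mulr_sumr.
rewrite (X1D w) (X2D w) 2!mulr_sumr -big_split/= mulr_sumr.
apply: ler_sum => b _.
rewrite -/(stopping (b :: w)); case: ifPn => [st|ns]; last first.
  by have := IH (b :: w); rewrite stopping_ancestor_cons.
rewrite subr0.
have A := mulr_ge0 (mulr_ge0 (ltW (m0 p)) (X20 p)) (X10 (b :: w)).
have C := mulr_ge0 (mulr_ge0 (ltW (m0 p)) (X10 p)) (X20 (b :: w)).
move: (st) => /andP[_]; rewrite -/p => /orP[] h.
- have /= := ler_wpM2l (X20 p) (ltW h); lra.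
- have /= := ler_wpM2l (X10 p) (ltW h); lra.
Qed.

(** At a stopping node, at least half of the volume is never stopped again. *)
Lemma stopping_sparse N w : stopping w -> m w <= 2 * unstopped_mass N m w.
Proof.
move=> st; have [x1 x2] := stopping_gt0 st.
have := unstopped_mass_ancestor N w; rewrite stopping_ancestor_id//.
have xx : 0 < X1 w * X2 w by rewrite mulr_gt0.
rewrite [leRHS](_ : _ = X1 w * X2 w * (2 * m w)); last by ring.
rewrite [leLHS](_ : _ = X1 w * X2 w * (4 * (m w - unstopped_mass N m w)));
  last by ring.
by rewrite ler_pM2l//; lra.
Qed.

Lemma unstopped_mass_holder N (a b c : R) (x y z : seq B -> R) w :
  0 < a -> 0 < b -> 0 < c -> a + b + c = 1 ->
  (forall v, 0 <= x v) -> (forall v, 0 <= y v) -> (forall v, 0 <= z v) ->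
  (forall v, m v <= x v `^ a * y v `^ b * z v `^ c) ->
  unstopped_mass N m w <= unstopped_mass N x w `^ a *
    unstopped_mass N y w `^ b * unstopped_mass N z w `^ c.
Proof.
move=> a0 b0 c0 abc x0 y0 z0 mxyz; elim: N w => //= N IH w.
apply: le_trans (sum_holder3 a0 b0 c0 abc _ _ _);
  try by move=> i; case: ifP => // _; exact: unstopped_mass_ge0.
apply: ler_sum => i _; case: ifP => // _.
Qed.

(** The term added to the Carleson sum is a Bellman function.  By bellman_step
    it absorbs the contribution of the node w itself, and by convexity its
    value at w is at most the sum of its values at the children. *)
Lemma carleson_embedding (r eta : R) (H s J : seq B -> R) N w :
  1 < r -> 0 <= eta -> (forall v, 0 <= H v) -> (forall v, 0 < s v) ->
  tree_additive H -> tree_additive s -> tree_additive J ->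
  (forall v, H v `^ r * s v `^ (1 - r) <= J v) ->
  (forall M v, stopping v -> eta * s v <= unstopped_mass M s v) ->
  eta * ((r - 1) * 2 `^ (- r)) *
    (\sum_(v <- descendants N w) (stopping v)%:R * (s v * (H v / s v) `^ r)) +
    H w `^ r * (s w + stopped_mass N s w) `^ (1 - r) <= J w.
Proof.
move=> r1 eta0 H0 s0 HD sD JD HsJ sparse.
have s0' v : 0 <= s v by exact: ltW.
have etaE M v : (stopping v)%:R * (eta * s v) <=
    (stopping v)%:R * unstopped_mass M s v.
  by case: (boolP (stopping v)) => [st|_]; rewrite ?mul0r// !mul1r sparse.
elim: N w => [|N IH] w.
  rewrite /= big_seq1 addr0; apply: le_trans (HsJ w).
  apply: (@bellman_step R r eta (H w) (s w) (s w) _ (stopping w)) => //.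
    exact: (etaE 0%N).
  by have := s0 w; case: stopping => /=; rewrite ?mul1r ?mul0r; lra.
rewrite sum_descendants stopped_massS.
set D := (stopping w)%:R * unstopped_mass N.+1 s w.
set W := \sum_b stopped_mass N s (b :: w).
have W0 : 0 <= W by apply: sumr_ge0 => b _; exact: stopped_mass_ge0.
have DW : D + W <= s w by rewrite -stopped_massS stopped_mass_le.
rewrite mulrDr addrAC (addrC D) addrA.
have step : eta * ((r - 1) * 2 `^ (- r)) *
      ((stopping w)%:R * (s w * (H w / s w) `^ r)) +
    H w `^ r * (s w + W + D) `^ (1 - r) <= H w `^ r * (s w + W) `^ (1 - r).
  apply: (@bellman_step R r eta (H w) (s w) (s w + W) D (stopping w)) => //.
  - by rewrite lerDl.
  - exact: etaE.
  - lra.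
apply: le_trans (lerD step (lexx _)) _.
set l := H w / (s w + W).
have sW0 : 0 < s w + W by rewrite ltr_pwDl.
(* the tangent plane for the slope l touches the graph at (H w, s w + W) *)
have -> : H w `^ r * (s w + W) `^ (1 - r) =
    r * l `^ (r - 1) * H w - (r - 1) * (l `^ r * (s w + W)).
  have l0 : 0 <= l by rewrite divr_ge0 ?(ltW sW0).
  have HE : H w = l * (s w + W) by rewrite divfK ?gt_eqF.
  rewrite {1 2}HE powRM ?(ltW sW0)// -mulrA -powRD ?(gt_eqF sW0) ?implybT//.
  rewrite subrKC powRr1 ?(ltW sW0)// mulrA -(mulrA r) (mulrC _ l).
  by rewrite mulr_powRB1//; [ring|lra].
have sWE : s w + W = \sum_b (s (b :: w) + stopped_mass N s (b :: w)).
  by rewrite big_split/= -sD.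
rewrite sWE (HD w) (JD w) !mulr_sumr -sumrB -big_split/=.
apply: ler_sum => b _; apply: le_trans (IH (b :: w)).
rewrite addrC mulr_sumr lerD2l.
have sb0 : 0 < s (b :: w) + stopped_mass N s (b :: w).
  by rewrite ltr_pwDl// stopped_mass_ge0.
have l0 : 0 <= l by rewrite divr_ge0 ?(ltW sW0).
have := young_tangent r1 l0 (H0 (b :: w)) sb0; lra.
Qed.

End stopping.
End tree.

(** * The sum over the stopping nodes *)

Section stopping_estimate.
Context {R : realType}.
Variables al p q t s q1 q2 r1 r2 : R.
Hypotheses (al0 : 0 <= al) (q0 : 0 < q) (qp : q <= p) (t0 : 0 < t) (ts : t <= s)
  (r10 : 0 < r1) (rq1 : r1 < q1) (r20 : 0 < r2) (rq2 : r2 < q2)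
  (hq : q^-1 = q1^-1 + q2^-1) (hs : s^-1 = p^-1 - al) (hts : t / s = q / p).

Let p0 : 0 < p. Proof. exact: lt_le_trans qp. Qed.
Let s0 : 0 < s. Proof. exact: lt_le_trans ts. Qed.
Let q10 : 0 < q1. Proof. exact: lt_trans rq1. Qed.
Let q20 : 0 < q2. Proof. exact: lt_trans rq2. Qed.

Lemma exponents_le : q <= t.
Proof.
have tE : t = q * (s / p) by rewrite mulrA mulrAC -hts divfK ?gt_eqF.
have ps : p <= s by rewrite -lef_pV2 ?posrE// hs gerBl.
by rewrite tE ler_peMr ?(ltW q0)// ler_pdivlMr// mul1r.
Qed.

Local Notation d1 := (dual_exponent r1 q1).
Local Notation d2 := (dual_exponent r2 q2).

(** The term of a cube of volume m in the maximal function, where X1 and X2 are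
    the integrals of |f|^r1 and |g|^r2 over it, and al is alpha/n. *)
Definition fractional_average (m X1 X2 : R) : R :=
  m `^ al * (X1 / m) `^ r1^-1 * (X2 / m) `^ r2^-1.

(** The testing condition, inserted in the term of one cube; V is the integral
    of v and s_i that of sigma_i. *)
Lemma fractional_average_testing (m V s1 s2 X1 X2 K : R) :
  0 < m -> 0 < V -> 0 < s1 -> 0 < s2 -> 0 < X1 -> 0 < X2 -> 0 <= K ->
  V `^ s^-1 * s1 `^ d1 * s2 `^ d2 <= K * m `^ (s^-1 + d1 + d2) ->
  fractional_average m X1 X2 * V `^ s^-1 <=
  K * (m `^ (p^-1 - q^-1) * (s1 * (X1 / s1) `^ (q1 / r1)) `^ q1^-1
    * (s2 * (X2 / s2) `^ (q2 / r2)) `^ q2^-1).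
Proof.
move=> m0 V0 s10 s20 X10 X20 K0 hK.
set Y := (X in K * X).
have Y0 : 0 < Y by rewrite /Y !mulr_gt0 ?powR_gt0 ?mulr_gt0 ?powR_gt0 ?divr_gt0.
rewrite [leLHS](_ : _ = V `^ s^-1 * s1 `^ d1 * s2 `^ d2 *
    (m `^ (- (s^-1 + d1 + d2)) * Y)).
  have EE : m `^ (s^-1 + d1 + d2) * m `^ (- (s^-1 + d1 + d2)) = 1.
    by rewrite -powRD ?(gt_eqF m0) ?implybT// subrr powRr0.
  apply: le_trans (ler_wpM2r _ hK) _.
    by rewrite mulr_ge0 ?powR_ge0 ?(ltW Y0).
  by rewrite -mulrA (mulrA (m `^ _)) EE mul1r.
rewrite /fractional_average /Y.
(* in logarithmic variables the identity of monomials is one of exponents *)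
move: (m) (V) (s1) (s2) (X1) (X2) m0 V0 s10 s20 X10 X20
  => m' V' s1' s2' X1' X2' /lnK <- /lnK <- /lnK <- /lnK <- /lnK <- /lnK <-.
rewrite -!expRN -!(expRM, expRD); congr expR.
rewrite /dual_exponent (_ : al = p^-1 - s^-1) ?hs; last by ring.
rewrite hq; field.
by rewrite !gt_eqF.
Qed.

(** Of the t powers of the Morrey quantity, t - q are bounded by N and the
    other q are kept for the summation over the stopping cubes. *)
Lemma fractional_average_term (m V s1 s2 X1 X2 K Nn : R) :
  0 < m -> 0 < V -> 0 < s1 -> 0 < s2 -> 0 < X1 -> 0 < X2 -> 0 <= K ->
  V `^ s^-1 * s1 `^ d1 * s2 `^ d2 <= K * m `^ (s^-1 + d1 + d2) ->
  m `^ (p^-1 - q^-1) * (s1 * (X1 / s1) `^ (q1 / r1)) `^ q1^-1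
    * (s2 * (X2 / s2) `^ (q2 / r2)) `^ q2^-1 <= Nn ->
  fractional_average m X1 X2 `^ t * (V `^ (t / s) * m `^ (1 - t / s)) <=
  K `^ t * Nn `^ (t - q) * ((s1 * (X1 / s1) `^ (q1 / r1)) `^ (q / q1)
    * (s2 * (X2 / s2) `^ (q2 / r2)) `^ (q / q2)).
Proof.
move=> m0 V0 s10 s20 X10 X20 K0 hK.
set Y := (X in X <= Nn) => hN.
have Y0 : 0 < Y by rewrite /Y !mulr_gt0 ?powR_gt0 ?mulr_gt0 ?powR_gt0 ?divr_gt0.
have c0 : 0 < fractional_average m X1 X2.
  by rewrite /fractional_average !mulr_gt0 ?powR_gt0 ?divr_gt0.
have cV : fractional_average m X1 X2 * V `^ s^-1 <= K * Y.
  exact: fractional_average_testing.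
have cVt : fractional_average m X1 X2 `^ t * (V `^ (t / s) * m `^ (1 - t / s)) =
    (fractional_average m X1 X2 * V `^ s^-1) `^ t * m `^ (1 - t / s).
  rewrite powRM; [|exact: ltW|exact: powR_ge0].
  by rewrite -powRrM (mulrC s^-1) mulrA.
rewrite [leLHS]cVt.
apply: (@le_trans _ _ ((K * Y) `^ t * m `^ (1 - t / s))).
  rewrite ler_wpM2r ?powR_ge0// ge0_ler_powR ?(ltW t0)// nnegrE.
    by rewrite mulr_ge0 ?powR_ge0 ?(ltW c0).
  by rewrite mulr_ge0 ?(ltW Y0).
rewrite powRM ?(ltW Y0)// -!mulrA ler_wpM2l ?powR_ge0//.
rewrite -[X in Y `^ X](subrK q) (@powRD _ Y (t - q) q) ?(gt_eqF Y0) ?implybT//.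
rewrite -mulrA ler_pM ?mulr_ge0 ?powR_ge0//.
  rewrite ge0_ler_powR ?subr_ge0 ?exponents_le ?nnegrE ?(ltW Y0)//.
  exact: le_trans (ltW Y0) hN.
rewrite le_eqVlt; apply/orP; left; apply/eqP; rewrite /Y hts.
move: (m) (s1) (s2) (X1) (X2) m0 s10 s20 X10 X20
  => m' s1' s2' X1' X2' /lnK <- /lnK <- /lnK <- /lnK <- /lnK <-.
rewrite -!expRN -!(expRM, expRD); congr expR.
field; by rewrite !gt_eqF.
Qed.

Section on_tree.
Context {B : finType}.
Variables m V s1 s2 X1 X2 J1 J2 : seq B -> R.
Variables K Nn : R.
Hypotheses (K0 : 0 <= K)
  (m0 : forall w, 0 < m w) (V0 : forall w, 0 < V w)
  (s10 : forall w, 0 < s1 w) (s20 : forall w, 0 < s2 w)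
  (X10 : forall w, 0 <= X1 w) (X20 : forall w, 0 <= X2 w)
  (mD : tree_additive m) (VD : tree_additive V)
  (s1D : tree_additive s1) (s2D : tree_additive s2)
  (X1D : tree_additive X1) (X2D : tree_additive X2)
  (J1D : tree_additive J1) (J2D : tree_additive J2)
  (XJ1 : forall w, X1 w `^ (q1 / r1) * s1 w `^ (1 - q1 / r1) <= J1 w)
  (XJ2 : forall w, X2 w `^ (q2 / r2) * s2 w `^ (1 - q2 / r2) <= J2 w)
  (X1nil : 0 < X1 [::]) (X2nil : 0 < X2 [::]).

Local Notation stopping := (stopping m X1 X2).
Local Notation unstopped_mass := (unstopped_mass m X1 X2).
Local Notation stopping_ancestor := (stopping_ancestor m X1 X2).

(** The unstopped part E of a stopping node P satisfies
    m(P) <= 2 m(E) <= 2 x(E)^a y(E)^b z(E)^c, while x^a y^b z^c <= L m on P;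
    comparing the two bounds the ratio y(P)/y(E). *)
Lemma unstopped_mass_A_infty (a b c L : R) (x y z : seq B -> R) N w :
  0 < a -> 0 < b -> 0 < c -> a + b + c = 1 -> 0 <= L ->
  (forall v, 0 < x v) -> (forall v, 0 < y v) -> (forall v, 0 < z v) ->
  tree_additive x -> tree_additive y -> tree_additive z ->
  (forall v, m v <= x v `^ a * y v `^ b * z v `^ c) ->
  (forall v, x v `^ a * y v `^ b * z v `^ c <= L * m v) ->
  stopping w -> y w <= (2 * L) `^ b^-1 * unstopped_mass N y w.
Proof.
move=> a0 b0 c0 abc L0 x0 y0 z0 xD yD zD lo up st.
have [x0' y0' z0'] :
    [/\ forall v, 0 <= x v, forall v, 0 <= y v & forall v, 0 <= z v].
  by split=> v; exact: ltW.
have h1 : m w <= 2 * unstopped_mass N m w by exact: stopping_sparse.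
have h2 : unstopped_mass N m w <= unstopped_mass N x w `^ a *
    unstopped_mass N y w `^ b * unstopped_mass N z w `^ c.
  exact: unstopped_mass_holder.
have ey : 0 <= unstopped_mass N y w by exact: unstopped_mass_ge0.
have h : y w `^ b <= 2 * L * unstopped_mass N y w `^ b.
  have P : 0 < x w `^ a * z w `^ c by rewrite mulr_gt0 ?powR_gt0.
  rewrite -(ler_pM2l P) mulrAC; apply: (le_trans (up w)).
  rewrite [leRHS](_ : _ =
    L * (2 * (x w `^ a * unstopped_mass N y w `^ b * z w `^ c))); last by ring.
  rewrite ler_wpM2l//; apply: (le_trans h1); rewrite ler_wpM2l//.
  apply: (le_trans h2); rewrite !ler_pM ?mulr_ge0 ?powR_ge0//.
    by rewrite ge0_ler_powR ?nnegrE ?unstopped_mass_ge0 ?unstopped_mass_le// ltW.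
  by rewrite ge0_ler_powR ?nnegrE ?unstopped_mass_ge0 ?unstopped_mass_le// ltW.
have E u : 0 <= u -> u = (u `^ b) `^ b^-1.
  by move=> u0; rewrite -powRrM divff ?gt_eqF// powRr1.
rewrite (E (y w))// [X in _ * X]E// -powRM ?powR_ge0 ?mulr_ge0//.
by rewrite ge0_ler_powR ?nnegrE ?mulr_ge0 ?powR_ge0 ?invr_ge0 ?(ltW b0).
Qed.

Local Notation kappa := (s^-1 + d1 + d2)^-1.

Hypotheses
  (m_le : forall w, m w <= V w `^ (kappa * s^-1) * s1 w `^ (kappa * d1)
    * s2 w `^ (kappa * d2))
  (testing : forall w,
    V w `^ s^-1 * s1 w `^ d1 * s2 w `^ d2 <= K * m w `^ (s^-1 + d1 + d2))
  (morrey : forall w,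
    m w `^ (p^-1 - q^-1) * J1 w `^ q1^-1 * J2 w `^ q2^-1 <= Nn).

Let d10 : 0 < d1.
Proof. by rewrite subr_gt0 ltf_pV2 ?posrE. Qed.
Let d20 : 0 < d2.
Proof. by rewrite subr_gt0 ltf_pV2 ?posrE. Qed.
Let si0 : 0 < s^-1. Proof. by rewrite invr_gt0. Qed.
Let sum0 : 0 < s^-1 + d1 + d2.
Proof. exact: addr_gt0 (addr_gt0 si0 d10) d20. Qed.
Let kappa0 : 0 < kappa. Proof. by rewrite invr_gt0. Qed.
Let kappa1 : kappa * s^-1 + kappa * d1 + kappa * d2 = 1.
Proof. by rewrite -!mulrDr mulVf// gt_eqF. Qed.

Let testing_kappa w :
  V w `^ (kappa * s^-1) * s1 w `^ (kappa * d1) * s2 w `^ (kappa * d2) <=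
  K `^ kappa * m w.
Proof.
have := testing w; have L0 : 0 <= V w `^ s^-1 * s1 w `^ d1 * s2 w `^ d2.
  by rewrite !mulr_ge0 ?powR_ge0.
move=> /(ge0_ler_powR (ltW kappa0)); rewrite !nnegrE L0 mulr_ge0 ?powR_ge0//.
move=> /(_ isT isT); rewrite !powRM ?mulr_ge0 ?powR_ge0// -!powRrM.
by rewrite !(mulrC _ kappa) mulVf ?powRr1 ?(ltW (m0 w))// gt_eqF.
Qed.

Let K_gt0 : 0 < K.
Proof.
rewrite lt_neqAle K0 andbT; apply/negP => /eqP KE.
have := testing [::]; rewrite -KE mul0r leNgt.
by rewrite !mulr_gt0 ?powR_gt0.
Qed.

(** The constant in the Carleson embedding for the dual weight with exponent d:
    the inverse of the unstopped fraction of its mass, which is given by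
    unstopped_mass_A_infty, over the Bellman constant. *)
Definition carleson_const (d r : R) : R :=
  (2 * K `^ kappa) `^ (kappa * d)^-1 / ((r - 1) * 2 `^ (- r)).

Lemma carleson_const_ge0 d r : 1 < r -> 0 <= carleson_const d r.
Proof.
move=> r_gt1; rewrite divr_ge0 ?powR_ge0// mulr_ge0 ?powR_ge0//.
by rewrite subr_ge0 ltW.
Qed.

Lemma stopping_energy (r d : R) (X sg J : seq B -> R) N :
  1 < r -> (forall w, 0 <= X w) -> (forall w, 0 < sg w) ->
  tree_additive X -> tree_additive sg -> tree_additive J ->
  (forall v, X v `^ r * sg v `^ (1 - r) <= J v) ->
  (forall M v, stopping v ->
    sg v <= (2 * K `^ kappa) `^ (kappa * d)^-1 * unstopped_mass M sg v) ->
  \sum_(v <- descendants N [::]) (stopping v)%:R * (sg v * (X v / sg v) `^ r)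
  <= carleson_const d r * J [::].
Proof.
move=> r1' X0 sg0 XD sgD JD XJ Ainf.
have Kk : 0 < (2 * K `^ kappa) `^ (kappa * d)^-1.
  by rewrite powR_gt0// mulr_gt0 ?powR_gt0.
have c0 : 0 < (r - 1) * 2 `^ (- r) by rewrite mulr_gt0 ?powR_gt0 ?subr_gt0.
have := @carleson_embedding _ _ m X1 X2 r ((2 * K `^ kappa) `^ (kappa * d)^-1)^-1
  X sg J N [::] r1' _ X0 sg0 XD sgD JD XJ.
rewrite invr_ge0 (ltW Kk) => /(_ isT) H.
rewrite /carleson_const mulrAC ler_pdivlMr// mulrC -ler_pdivrMl// mulrA.
apply: le_trans (H _); first by rewrite lerDl mulr_ge0 ?powR_ge0.
by move=> M v st; rewrite ler_pdivrMl//; exact: Ainf.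
Qed.

(** The constant of the sum over the stopping nodes; it depends on the testing
    constant K. *)
Definition testing_const : R := q / q1 * carleson_const d1 (q1 / r1)
  + q / q2 * carleson_const d2 (q2 / r2).

Lemma testing_const_ge0 : 0 <= testing_const.
Proof.
have h1 : 1 < q1 / r1 by rewrite ltr_pdivlMr ?mul1r.
have h2 : 1 < q2 / r2 by rewrite ltr_pdivlMr ?mul1r.
apply: addr_ge0; (apply: mulr_ge0; last exact: carleson_const_ge0).
  by rewrite divr_ge0// ltW.
by rewrite divr_ge0// ltW.
Qed.

Lemma stopping_sum_le N :
  \sum_(v <- descendants N [::]) (stopping v)%:R *
    (fractional_average (m v) (X1 v) (X2 v) `^ t *
       (V v `^ (t / s) * m v `^ (1 - t / s))) <=
  testing_const * (K * Nn) `^ t * m [::] `^ (1 - t / s).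
Proof.
set A1 := fun v => s1 v * (X1 v / s1 v) `^ (q1 / r1).
set A2 := fun v => s2 v * (X2 v / s2 v) `^ (q2 / r2).
have rho1 : 1 < q1 / r1 by rewrite ltr_pdivlMr ?mul1r.
have rho2 : 1 < q2 / r2 by rewrite ltr_pdivlMr ?mul1r.
have A10 v : 0 <= A1 v by rewrite mulr_ge0 ?powR_ge0 ?(ltW (s10 v)).
have A20 v : 0 <= A2 v by rewrite mulr_ge0 ?powR_ge0 ?(ltW (s20 v)).
have A1J v : A1 v <= J1 v by rewrite /A1 energyE.
have A2J v : A2 v <= J2 v by rewrite /A2 energyE.
have J10 v : 0 <= J1 v by exact: le_trans (A1J v).
have J20 v : 0 <= J2 v by exact: le_trans (A2J v).
have J1nil : 0 < J1 [::].
  by apply: lt_le_trans (A1J _); rewrite mulr_gt0 ?powR_gt0 ?divr_gt0.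
have J2nil : 0 < J2 [::].
  by apply: lt_le_trans (A2J _); rewrite mulr_gt0 ?powR_gt0 ?divr_gt0.
have Nn0 : 0 < Nn.
  by apply: lt_le_trans (morrey [::]); rewrite !mulr_gt0 ?powR_gt0.
have AN v : m v `^ (p^-1 - q^-1) * A1 v `^ q1^-1 * A2 v `^ q2^-1 <= Nn.
  apply: le_trans (morrey v); rewrite ler_pM ?mulr_ge0 ?powR_ge0//.
    by rewrite ler_wpM2l ?powR_ge0// ge0_ler_powR ?invr_ge0 ?nnegrE ?(ltW q10).
  by rewrite ge0_ler_powR ?invr_ge0 ?nnegrE ?(ltW q20).
have KL0 : 0 <= K `^ kappa by exact: powR_ge0.
have E1 : \sum_(v <- descendants N [::]) (stopping v)%:R * A1 v <=
    carleson_const d1 (q1 / r1) * J1 [::].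
  apply: stopping_energy => // M v st.
  by apply: (unstopped_mass_A_infty M _ _ _ kappa1 KL0 V0 s10 s20 VD s1D s2D m_le
    testing_kappa st); rewrite mulr_gt0.
have E2 : \sum_(v <- descendants N [::]) (stopping v)%:R * A2 v <=
    carleson_const d2 (q2 / r2) * J2 [::].
  apply: stopping_energy => // M v st.
  apply: (@unstopped_mass_A_infty (kappa * s^-1) (kappa * d2) (kappa * d1)
    _ V s2 s1 M v) => //; rewrite ?mulr_gt0//.
  - by rewrite addrAC.
  - by move=> u; rewrite mulrAC.
  - by move=> u; rewrite mulrAC.
have qq1 : 0 < q / q1 by rewrite divr_gt0.
have qq2 : 0 < q / q2 by rewrite divr_gt0.
have qq : q / q1 + q / q2 + 0 = 1 by rewrite addr0 -mulrDr -hq divff ?gt_eqF.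
set M := K `^ t * Nn `^ (t - q).
have M0 : 0 <= M by rewrite mulr_ge0 ?powR_ge0.
set I := J1 [::] `^ (q / q1) * J2 [::] `^ (q / q2).
have I0 : 0 <= I by rewrite mulr_ge0 ?powR_ge0.
apply: (@le_trans _ _ (\sum_(v <- descendants N [::]) M * I *
   (q / q1 / J1 [::] * ((stopping v)%:R * A1 v) +
    q / q2 / J2 [::] * ((stopping v)%:R * A2 v)))).
  apply: ler_sum => v _.
  have [st|_] := boolP (stopping v); last by rewrite !mul0r !mulr0 addr0 mulr0.
  rewrite !mul1r.
  have [x1 x2] : 0 < X1 v /\ 0 < X2 v by exact: stopping_gt0 st.
  apply: le_trans
    (fractional_average_term _ _ _ _ _ _ K0 (testing v) (AN v)) _ => //.
  rewrite -/M -mulrA ler_wpM2l//.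
  have := @weighted_amgm3_scaled R (q / q1) (q / q2) 0 (A1 v) (A2 v) 1
    (J1 [::]) (J2 [::]) 1 (ltW qq1) (ltW qq2) (lexx _) qq (A10 v) (A20 v) ler01
    J1nil J2nil ltr01.
  by rewrite !powRr0 !mulr1 mul0r addr0.
rewrite -mulr_sumr big_split/= -!mulr_sumr.
have step :
    q / q1 / J1 [::] * (\sum_(v <- descendants N [::]) (stopping v)%:R * A1 v) +
    q / q2 / J2 [::] * (\sum_(v <- descendants N [::]) (stopping v)%:R * A2 v)
    <= testing_const.
  apply: lerD.
    rewrite -mulrA ler_wpM2l ?(ltW qq1)//.
    by rewrite mulrC ler_pdivrMr.
  rewrite -mulrA ler_wpM2l ?(ltW qq2)//.
  by rewrite mulrC ler_pdivrMr.
apply: (le_trans (ler_wpM2l (mulr_ge0 M0 I0) step)).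
rewrite mulrC -mulrA ler_wpM2l ?testing_const_ge0//.
rewrite powRM ?(ltW Nn0)// /M -!mulrA ler_wpM2l ?powR_ge0//.
rewrite -[X in _ <= Nn `^ X * _](subrK q).
rewrite (@powRD _ Nn (t - q) q) ?(gt_eqF Nn0) ?implybT//.
rewrite -mulrA ler_wpM2l ?powR_ge0//.
have := morrey [::].
move=> /(ge0_ler_powR (ltW q0)); rewrite !nnegrE !mulr_ge0 ?powR_ge0 ?(ltW Nn0)//.
move=> /(_ isT isT) /(ler_wpM2r (powR_ge0 (m [::]) (1 - t / s))).
apply: le_trans; rewrite !powRM ?mulr_ge0 ?powR_ge0// -!powRrM /I.
rewrite [leRHS](_ : _ = (m [::] `^ ((p^-1 - q^-1) * q) * m [::] `^ (1 - t / s)) *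
  (J1 [::] `^ (q1^-1 * q) * J2 [::] `^ (q2^-1 * q))); last by ring.
rewrite -powRD ?(gt_eqF (m0 _)) ?implybT// hts mulrBl mulVf ?gt_eqF//.
rewrite (_ : _ + _ = 0); last by ring.
by rewrite powRr0 mul1r !(mulrC _ q).
Qed.

(** The term of a node is controlled by that of its stopping ancestor; the
    factor m^al only grows towards the root since al >= 0. *)
Lemma fractional_average_ancestor w :
  fractional_average (m w) (X1 w) (X2 w) <=
  4 `^ (r1^-1 + r2^-1) * fractional_average (m (stopping_ancestor w))
    (X1 (stopping_ancestor w)) (X2 (stopping_ancestor w)).
Proof.
set pw := stopping_ancestor w.
have R0 : 0 <= 4 `^ (r1^-1 + r2^-1) * fractional_average (m pw) (X1 pw) (X2 pw).
  by rewrite !mulr_ge0 ?powR_ge0.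
have : 0 <= X1 w * X2 w by rewrite mulr_ge0.
rewrite le_eqVlt => /predU1P[/esym/eqP|XX].
  rewrite mulf_eq0 => /orP[/eqP XE|/eqP XE]; apply: le_trans R0;
    rewrite /fractional_average XE mul0r powR0 ?mulr0 ?mul0r// gt_eqF ?invr_gt0//.
have mono v : m v <= m (stopping_ancestor v).
  elim: v => //= b v IH; case: ifP => // _; apply: le_trans IH.
  rewrite [leRHS]mD (bigD1 b)//= lerDl sumr_ge0// => i _; exact: ltW.
have [h1 h2] : X1 w * m pw <= 4 * X1 pw * m w /\ X2 w * m pw <= 4 * X2 pw * m w.
  exact: stopping_ancestor_average.
have frac X : X w * m pw <= 4 * X pw * m w -> X w / m w <= 4 * (X pw / m pw).
  by move=> h; rewrite mulrA ler_pdivlMr// mulrAC ler_pdivrMr.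
have d0 (X : seq B -> R) v : 0 <= X v -> 0 <= X v / m v.
  by move=> X0; rewrite divr_ge0// ltW.
have pos4 (X : seq B -> R) v : 0 <= X v -> 0 <= 4 * (X v / m v).
  by move=> X0; rewrite mulr_ge0// d0.
rewrite /fractional_average (@powRD _ 4) ?pnatr_eq0 ?implybT//.
rewrite [leRHS](_ : _ = m pw `^ al * (4 * (X1 pw / m pw)) `^ r1^-1
    * (4 * (X2 pw / m pw)) `^ r2^-1); last first.
  rewrite (@powRM _ 4 (X1 pw / m pw)) ?d0//.
  by rewrite (@powRM _ 4 (X2 pw / m pw)) ?d0//; ring.
rewrite !ler_pM ?mulr_ge0 ?powR_ge0//.
- by rewrite ge0_ler_powR ?nnegrE ?(ltW (m0 _))// mono.
- by rewrite ge0_ler_powR ?invr_ge0 ?nnegrE ?(ltW r10) ?pos4 ?d0// frac.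
- by rewrite ge0_ler_powR ?invr_ge0 ?nnegrE ?(ltW r20) ?pos4 ?d0// frac.
Qed.

End on_tree.
End stopping_estimate.

(** * The tree of dyadic subcubes of a cube *)

Section dyadic_tree.
Context {R : realType} {n : nat}.
Implicit Types (k : int) (m : 'I_n -> int) (x : Rn R n).
Implicit Types (w : seq {ffun 'I_n -> bool}).
Local Notation word := (seq {ffun 'I_n -> bool}).

(** The halves of the cube 2^-k ([0,1)^n + m) in each direction are indexed by
    bit vectors e: the child for e has the corner 2m + e at level k + 1.  A
    word, read from right to left, is a sequence of such choices. *)
Fixpoint dyadic_corner m (w : word) : 'I_n -> int :=
  if w is e :: w' then fun i => 2 * dyadic_corner m w' i + (e i : nat)%:Z else m.

(** The subcube of 2^-k ([0,1)^n + m) reached by a word. *)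
Definition dyadic_descendant k m (w : word) : set (Rn R n) :=
  dyadic_cube (k + (size w)%:Z) (dyadic_corner m w).

Lemma dyadic_cube_corner k m m' x :
  dyadic_cube k m x -> dyadic_cube k m' x -> m = m'.
Proof.
have h0 : (0 : R) < 2 ^ (- k) by rewrite exprz_gt0.
have le a b (y : R) : 2 ^ (- k) * a%:~R <= y -> y < 2 ^ (- k) * (b%:~R + 1) ->
    a <= b.
  move=> ay yb; have := le_lt_trans ay yb; rewrite ltr_pM2l//.
  by rewrite -(intrD _ b 1) ltr_int ltzD1.
move=> xm xm'; apply/funext => i; apply/eqP; rewrite eq_le.
have /andP[a b] := xm i; have /andP[c d] := xm' i.
by rewrite (le _ _ _ a d) (le _ _ _ c b).
Qed.

Lemma dyadic_descendant_cons k m (w : word) x :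
  dyadic_descendant k m w x <-> exists e, dyadic_descendant k m (e :: w) x.
Proof.
rewrite /dyadic_descendant /dyadic_cube /=.
rewrite intS (addrC 1) addrA.
move: (k + (size w)%:Z) (dyadic_corner m w) => k' m'.
have h0 : (0 : R) < 2 ^ (- (k' + 1)) by rewrite exprz_gt0.
have hE : (2 : R) ^ (- k') = 2 * 2 ^ (- (k' + 1)).
  by rewrite opprD expfzDr// mulrCA mulfV ?mulr1.
rewrite hE; move: (2 ^ (- (k' + 1))) h0 => h h0.
have cE a (b : bool) : (2 * a + (b : nat)%:Z)%:~R = 2 * a%:~R + b%:R :> R.
  by rewrite intrD intrM -!pmulrn.
split=> [xQ|[e xQ] i /=].
  exists [ffun i => h * (2 * (m' i)%:~R + 1) <= Defs.coord x i] => i /=.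
  rewrite ffunE cE; have := xQ i => /=.
  case: (leP (h * (2 * (m' i)%:~R + 1)) (Defs.coord x i)) => /= a /andP[b c];
    by apply/andP; split; rewrite /= ?mulr1n ?mulr0n; lra.
have := xQ i; rewrite /= cE => /andP[].
by case: (e i) => /=; rewrite ?mulr1n ?mulr0n => a b; apply/andP; split; lra.
Qed.

Lemma dyadic_descendant_size k m x (j : nat) : dyadic_cube k m x ->
  exists2 w, size w = j & dyadic_descendant k m w x.
Proof.
move=> xQ; elim: j => [|j [w <- xw]].
  by exists [::] => //; rewrite /dyadic_descendant addr0.
by have [e xe] := (dyadic_descendant_cons k m w x).1 xw; exists (e :: w).
Qed.

Lemma dyadic_descendant_root k m (w : word) :
  dyadic_descendant k m w `<=` dyadic_cube k m.
Proof.
elim: w => [|e w IH] x; first by rewrite /dyadic_descendant addr0.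
by move=> xw; apply: IH; apply/dyadic_descendant_cons; exists e.
Qed.

Lemma dyadic_descendantP k m k' m' x (j : nat) : k' = k + j%:Z ->
  dyadic_cube k m x -> dyadic_cube k' m' x ->
  exists w, dyadic_cube k' m' = dyadic_descendant k m w.
Proof.
move=> -> xQ xQ'; have [w wj xw] := dyadic_descendant_size j xQ.
exists w; rewrite /dyadic_descendant wj; congr dyadic_cube.
by apply: dyadic_cube_corner xQ' _; rewrite -wj.
Qed.

(** A dyadic cube meeting the cube (k, m) contains it or is one of its
    descendants. *)
Lemma dyadic_nested k m (Q : set (Rn R n)) x : dyadic Q -> Q x ->
  dyadic_cube k m x ->
  dyadic_cube k m `<=` Q \/ exists w, Q = dyadic_descendant k m w.
Proof.
move=> [k' [m' ->]] xQ' xQ.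
have [kk'|/ltW k'k] := leP k k'.
  right; apply: (@dyadic_descendantP k m k' m' x `|k' - k|%N) => //.
  by rewrite gez0_abs ?subr_ge0// subrKC.
left; have [|w ->] := @dyadic_descendantP k' m' k m x `|k - k'|%N _ xQ' xQ.
  by rewrite gez0_abs ?subr_ge0// subrKC.
exact: dyadic_descendant_root.
Qed.

Lemma measurable_dyadic_descendant k m w : measurable (dyadic_descendant k m w).
Proof. exact: (lebesgue_dyadic_cube _ _).1. Qed.

Lemma dyadic_descendant_bigsetU k m w : dyadic_descendant k m w =
  \big[setU/set0]_(e <- enum {ffun 'I_n -> bool}) dyadic_descendant k m (e :: w).
Proof.
apply/seteqP; split=> x.
  move/dyadic_descendant_cons => [e xe]; rewrite -bigcup_seq; exists e => //=.
  by rewrite mem_enum.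
by rewrite -bigcup_seq => -[e _ xe]; apply/dyadic_descendant_cons; exists e.
Qed.

Lemma dyadic_descendant_trivIset k m w :
  trivIset setT (fun e => dyadic_descendant k m (e :: w)).
Proof.
move=> e e' _ _ [x [xe xe']]; apply/ffunP => i.
have := dyadic_cube_corner xe xe' => /= /(congr1 (fun f => f i)) /= /addrI.
by case: (e i); case: (e' i).
Qed.

Lemma integral_dyadic_descendant k m w (F : Rn R n -> \bar R) :
  measurable_fun [set: Rn R n] F -> (forall x, (0 <= F x)%E) ->
  (\int[lebesgue]_(x in dyadic_descendant k m w) F x =
  \sum_(e : {ffun 'I_n -> bool})
     \int[lebesgue]_(x in dyadic_descendant k m (e :: w)) F x)%E.
Proof.
move=> mF F0; rewrite dyadic_descendant_bigsetU ge0_integral_bigsetU//.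
- by rewrite big_enum.
- by move=> e; exact: measurable_dyadic_descendant.
- exact: enum_uniq.
- by move=> e e' _ _ ee'; exact: (@dyadic_descendant_trivIset k m w).
- exact: measurable_funTS.
Qed.

End dyadic_tree.

(** * Extended real numbers and integrals *)

Section extended_real_inequalities.
Context {R : realType}.
Implicit Types x y : \bar R.

Lemma lee_poweR (r : R) x y : 0 <= r -> (0 <= x)%E -> (x <= y)%E ->
  (x `^ r <= y `^ r)%E.
Proof.
move=> r0 x0 xy; apply: gt0_ler_poweR => //; rewrite in_itv/= leey andbT//.
exact: le_trans xy.
Qed.

Lemma mule_gt0_lty x y : (0 < x)%E -> (0 < y)%E ->
  (x * y < +oo)%E -> (x < +oo)%E /\ (y < +oo)%E.
Proof.
move: x y => [x| |] [y| |] //=; rewrite ?ltry//.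
- by move=> x0 _; rewrite mulry gtr0_sg// mul1e ltxx.
- by move=> _ y0; rewrite mulyr gtr0_sg// mul1e ltxx.
Qed.

(** To bound (sup S * w)^t by H it is enough to bound each term, also when H
    is infinite. *)
Lemma ereal_sup_powR_bound (S : set \bar R) (t w : R) (H : \bar R) :
  0 < t -> 0 <= w -> (exists2 y, S y & (0 <= y)%E) -> (0 <= H)%E ->
  (forall y, S y -> exists2 a : R, 0 <= a &
    (y <= a%:E)%E /\ ((a `^ t * w `^ t)%:E <= H)%E) ->
  (`|ereal_sup S * w%:E| `^ t <= H)%E.
Proof.
move=> t0; rewrite le_eqVlt => /predU1P[<- _ H0 _|w0 [y0 Sy0 y00] H0 SH].
  by rewrite mule0 abse0 poweR0r ?gt_eqF.
have sup0 : (0 <= ereal_sup S)%E by apply: le_trans y00 _; exact: ereal_sup_ubound.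
have wt0 : 0 < w `^ t by rewrite powR_gt0.
set Y := ((H * ((w `^ t)^-1)%:E) `^ t^-1)%E.
have Hw0 : (0 <= H * ((w `^ t)^-1)%:E)%E by rewrite mule_ge0// lee_fin invr_ge0 ltW.
have Y0 : (0 <= Y)%E by exact: poweR_ge0.
have supY : (ereal_sup S <= Y)%E.
  apply: ge_ereal_sup => y Sy; have [a a0 [ya aH]] := SH y Sy.
  apply: le_trans ya _.
  have -> : a%:E = ((a `^ t)%:E `^ t^-1)%E.
    by rewrite poweR_EFin -powRrM divff ?gt_eqF// powRr1.
  apply: lee_poweR; rewrite ?invr_ge0 ?(ltW t0) ?lee_fin ?powR_ge0//.
  by rewrite lee_pdivlMr.
rewrite gee0_abs; last by rewrite mule_ge0// lee_fin ltW.
apply: (@le_trans _ _ ((Y * w%:E) `^ t)%E).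
  apply: lee_poweR; rewrite ?(ltW t0)//; first by rewrite mule_ge0// lee_fin ltW.
  by rewrite lee_wpmul2r// lee_fin ltW.
rewrite poweRM// ?lee_fin ?(ltW w0)// /Y -poweRrM mulVf ?gt_eqF// poweRe1//.
by rewrite poweR_EFin -muleA -EFinM mulVf ?gt_eqF// mule1.
Qed.

End extended_real_inequalities.

Section measure_inequalities.
Context d (T : measurableType d) (R : realType).
Variables (mu : {measure set T -> \bar R}) (D : set T) (mD : measurable D).

(** Monotonicity of the integral of non-negative functions needs no
    measurability: the integral is the supremum over the simple functions
    below.  It spares the measurability of the maximal function. *)
Lemma ge0_le_integral_nonmeasurable (f1 f2 : T -> \bar R) :
  (forall x, D x -> (0 <= f1 x)%E) -> (forall x, D x -> (f1 x <= f2 x)%E) ->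
  (\int[mu]_(x in D) f1 x <= \int[mu]_(x in D) f2 x)%E.
Proof.
move=> f10 f12; rewrite !ge0_integralE//; last first.
  by move=> x Dx; apply: le_trans (f12 x Dx); exact: f10.
apply: ereal_sup_le => _ [h hf <-]; exists h => // x.
by apply: le_trans (hf x) _; exact: lee_restrict.
Qed.

(** Hölder's inequality with three factors, some exponents possibly zero, in
    terms of positive upper bounds of the three integrals. *)
Lemma integral_holder3 (F x y z : T -> R) (a b c A B C : R) :
  0 <= a -> 0 <= b -> 0 <= c -> a + b + c = 1 ->
  0 < A -> 0 < B -> 0 < C ->
  measurable_fun D F -> measurable_fun D x -> measurable_fun D y ->
  measurable_fun D z ->
  (forall t, 0 <= F t) -> (forall t, 0 <= x t) -> (forall t, 0 <= y t) ->
  (forall t, 0 <= z t) ->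
  {ae mu, forall t, D t -> F t <= x t `^ a * y t `^ b * z t `^ c} ->
  (\int[mu]_(t in D) (x t)%:E <= A%:E)%E ->
  (\int[mu]_(t in D) (y t)%:E <= B%:E)%E ->
  (\int[mu]_(t in D) (z t)%:E <= C%:E)%E ->
  (\int[mu]_(t in D) (F t)%:E <= (A `^ a * B `^ b * C `^ c)%:E)%E.
Proof.
move=> a0 b0 c0 abc A0 B0 C0 mF mx my mz F0 x0 y0 z0 Fxyz xA yB zC.
set M := A `^ a * B `^ b * C `^ c.
have M0 : 0 <= M by rewrite !mulr_ge0 ?powR_ge0.
have [kA kB kC] : [/\ 0 <= M * (a / A), 0 <= M * (b / B) & 0 <= M * (c / C)].
  by split; rewrite mulr_ge0// divr_ge0// ltW.
have mE (f : T -> R) k : measurable_fun D f ->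
    measurable_fun D (fun t => k%:E * (f t)%:E)%E.
  by move=> mf; apply/measurable_EFinP; exact: measurable_funM.
have pos (f : T -> R) k t : 0 <= k -> 0 <= f t -> (0 <= k%:E * (f t)%:E)%E.
  by move=> k0 f0; rewrite -EFinM lee_fin mulr_ge0.
apply: (@le_trans _ _ (\int[mu]_(t in D) ((M * (a / A))%:E * (x t)%:E +
    (M * (b / B))%:E * (y t)%:E + (M * (c / C))%:E * (z t)%:E))%E).
  apply: ae_ge0_le_integral => //.
  - by move=> t _; rewrite lee_fin.
  - exact/measurable_EFinP.
  - by move=> t _; rewrite !adde_ge0// pos.
  - by do ?apply: emeasurable_funD; exact: mE.
  apply: filterS Fxyz => t h Dt; rewrite -!EFinM -!EFinD lee_fin.
  apply: le_trans (h Dt) _; apply: le_trans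
    (weighted_amgm3_scaled a0 b0 c0 abc (x0 t) (y0 t) (z0 t) A0 B0 C0) _.
  by rewrite -/M !mulrDr !mulrA.
rewrite ge0_integralD//; last 4 first.
- by move=> t _; rewrite !adde_ge0// pos.
- by do ?apply: emeasurable_funD; exact: mE.
- by move=> t _; rewrite pos.
- exact: mE.
rewrite ge0_integralD//; last 4 first.
- by move=> t _; rewrite pos.
- exact: mE.
- by move=> t _; rewrite pos.
- exact: mE.
have mF' (f : T -> R) : measurable_fun D f -> measurable_fun D (fun t => (f t)%:E).
  by move=> mf; exact/measurable_EFinP.
rewrite !ge0_integralZl_EFin//; try by [move=> t _; rewrite lee_fin|exact: mF'].
apply: (@le_trans _ _ ((M * (a / A))%:E * A%:E + (M * (b / B))%:E * B%:E +
    (M * (c / C))%:E * C%:E)%E).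
  by do ?apply: leeD; apply: lee_wpmul2l; rewrite ?lee_fin.
rewrite -!EFinM -!EFinD lee_fin -!(mulrA M) !divfK ?gt_eqF// -!mulrDr abc.
by rewrite mulr1.
Qed.

Lemma integral_eq0_ae (f : T -> \bar R) : measurable_fun D f ->
  (forall x, D x -> (0 <= f x)%E) -> (\int[mu]_(x in D) f x = 0)%E ->
  {ae mu, forall x, D x -> f x = 0%E}.
Proof.
move=> mf f0 int0; apply/(ae_eq_integral_abs mu mD mf); rewrite -int0.
by apply: eq_integral => x; rewrite inE => Dx; rewrite gee0_abs// f0.
Qed.

Lemma integral_gt0 (f : T -> \bar R) : measurable_fun D f ->
  {ae mu, forall x, D x -> (0 < f x)%E} -> (forall x, D x -> (0 <= f x)%E) ->
  (0 < mu D)%E -> (0 < \int[mu]_(x in D) f x)%E.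
Proof.
move=> mf fpos f0 muD; rewrite lt_neqAle integral_ge0// andbT.
apply/negP => /eqP /esym /(integral_eq0_ae mf f0) fz.
suff : mu D = 0%E by move=> D0; rewrite D0 ltxx in muD.
apply: (measure_negligible mD); have : {ae mu, forall x, ~ D x}.
  by apply: filterS2 fpos fz => x fx0 fx Dx; have := fx0 Dx; rewrite fx// ltxx.
by apply: negligibleS => x Dx; apply.
Qed.

Lemma integral_lty_ae (f : T -> \bar R) : measurable_fun D f ->
  (forall x, D x -> (0 <= f x)%E) -> (\int[mu]_(x in D) f x < +oo)%E ->
  {ae mu, forall x, D x -> (f x < +oo)%E}.
Proof.
move=> mf f0 fi; have fI : mu.-integrable D f.
  apply/integrableP; split => //; rewrite (eq_integral f)//.
  by move=> x; rewrite inE => Dx; rewrite gee0_abs// f0.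
by apply: filterS (integrable_ae mD fI) => x h Dx; rewrite -ge0_fin_numE ?f0// h.
Qed.

Lemma nondecreasing_integral_bound (g : nat -> T -> \bar R) (C : \bar R) :
  (forall N, measurable_fun D (g N)) -> (forall N x, D x -> (0 <= g N x)%E) ->
  (forall x, D x -> {homo g^~ x : N M / (N <= M)%N >-> (N <= M)%E}) ->
  (forall N, \int[mu]_(x in D) g N x <= C)%E ->
  (\int[mu]_(x in D) ereal_sup (range (g^~ x)) <= C)%E.
Proof.
move=> mg g0 ndg gC.
rewrite (eq_integral (fun x => limn (g^~ x))); last first.
  move=> x; rewrite inE => Dx; apply/esym/cvg_lim => //.
  exact/ereal_nondecreasing_cvgn/ndg.
have cv := @cvg_monotone_convergence _ _ _ mu _ mD _ mg g0 ndg.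
rewrite -(cvg_lim _ cv)//; apply: lime_le; first by apply/cvg_ex; eexists; exact: cv.
by apply: nearW => N; exact: gC.
Qed.

End measure_inequalities.

(** * Weights on dyadic cubes *)

Section cubes.
Context {R : realType} {n : nat}.
Implicit Types (Q : set (Rn R n)) (u f : Rn R n -> R).
Local Notation mu := (@lebesgue R n).

Lemma dyadic_measure Q : dyadic Q ->
  measurable Q /\ exists2 c : R, 0 < c & mu Q = c%:E.
Proof.
move=> [k [m ->]]; have [mQ muQ] := @lebesgue_dyadic_cube R n k m.
by split=> //; eexists; last exact: muQ; rewrite exprn_gt0// exprz_gt0.
Qed.

Lemma avgE Q (c : R) (F : Rn R n -> \bar R) : 0 < c -> mu Q = c%:E ->
  avg Q F = (c^-1%:E * \int[mu]_(x in Q) F x)%E.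
Proof. by move=> c0 Qc; rewrite /avg Qc inver gt_eqF. Qed.

Lemma avg_EFin Q (c I : R) (F : Rn R n -> \bar R) (e : R) : 0 < c -> mu Q = c%:E ->
  (\int[mu]_(x in Q) F x = I%:E)%E -> (avg Q F `^ e = ((I / c) `^ e)%:E)%E.
Proof. by move=> c0 Qc FI; rewrite (avgE _ c0 Qc) FI -EFinM mulrC poweR_EFin. Qed.

(** The dual weight u^(-r/(q-r)) as a real function.  Where u vanishes its value
    is 0 instead of +oo; on the cubes of interest u is positive almost
    everywhere, so that its integrals are those of neg_power. *)
Definition dual_weight (u : Rn R n -> R) (r q : R) (x : Rn R n) : R :=
  u x `^ (- (r / (q - r))).

Lemma measurable_powR_comp u (e : R) : measurable_fun [set: Rn R n] u ->
  measurable_fun [set: Rn R n] (fun x => u x `^ e).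
Proof. by move=> mu'; exact: (measurableT_comp (measurable_powR e)). Qed.

Lemma measurable_neg_power u (a : R) : measurable_fun [set: Rn R n] u ->
  measurable_fun [set: Rn R n] (neg_power u a).
Proof.
move=> mu'; have mua := measurable_powR_comp a mu'.
rewrite (_ : neg_power u a =
    fun x => if u x `^ a == 0 then +oo%E else ((u x `^ a) `^ (-1))%:E).
  apply: (@measurable_fun_ifT _ _ _ _ (fun=> +oo%E)
    (fun x => ((u x `^ a) `^ (-1))%:E) (fun x => u x `^ a == 0)).
  - exact: (measurable_fun_eqr mua (measurable_cst (0 : R))).
  - exact: measurable_cst.
  - by apply/measurable_EFinP; exact: (measurable_powR_comp (-1) mua).
apply/funext => x; rewrite /neg_power inver; case: ifP => // _.
by rewrite powR_inv1// powR_ge0.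
Qed.

Lemma neg_power_gt0 u (a : R) x : (0 < neg_power u a x)%E.
Proof.
rewrite /neg_power inver; case: eqP => // /eqP ua.
by rewrite lte_fin invr_gt0 lt_neqAle eq_sym ua powR_ge0.
Qed.

Lemma dual_weight_le u (r q : R) x : 0 < r -> r < q ->
  ((dual_weight u r q x)%:E <= neg_power u (r / (q - r)) x)%E.
Proof.
move=> r0 rq; rewrite /neg_power inver /dual_weight powRN.
by case: ifP => // _; rewrite leey.
Qed.

Lemma neg_power_lty u (a : R) x : 0 < a -> 0 <= u x ->
  (neg_power u a x < +oo)%E -> 0 < u x.
Proof.
move=> a0 u0 h; rewrite lt_neqAle u0 andbT; apply: contraTneq h => ux.
by rewrite /neg_power -ux powR0 ?gt_eqF// inve0 ltxx.
Qed.

(** The integral over Q as a real number; meaningful when it is finite. *)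
Definition cube_integral (F : Rn R n -> R) Q : R :=
  fine (\int[mu]_(x in Q) (F x)%:E)%E.

Lemma cube_integral_ge0 F Q : (forall x, 0 <= F x) -> 0 <= cube_integral F Q.
Proof. by move=> F0; rewrite fine_ge0// integral_ge0// => x _; rewrite lee_fin. Qed.

Lemma cube_integralE F Q : (forall x, 0 <= F x) ->
  (\int[mu]_(x in Q) (F x)%:E < +oo)%E ->
  (\int[mu]_(x in Q) (F x)%:E = (cube_integral F Q)%:E)%E.
Proof.
move=> F0 Foo; rewrite fineK// ge0_fin_numE// integral_ge0// => x _.
by rewrite lee_fin.
Qed.

Lemma fin_integral_pos Q (F : Rn R n -> R) : (forall x, 0 <= F x) ->
  (0 < \int[mu]_(x in Q) (F x)%:E < +oo)%E ->
  0 < cube_integral F Q /\ (\int[mu]_(x in Q) (F x)%:E = (cube_integral F Q)%:E)%E.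
Proof.
move=> F0 /andP[Fpos Foo]; have FE := cube_integralE F0 Foo; split=> //.
by rewrite -lte_fin -FE.
Qed.

Section regular_cubes.
Variables (s q1 q2 r1 r2 K : R) (u1 u2 : Rn R n -> R).
Hypotheses (s0 : 0 < s) (r10 : 0 < r1) (rq1 : r1 < q1) (r20 : 0 < r2)
  (rq2 : r2 < q2) (mu1 : measurable_fun [set: Rn R n] u1)
  (mu2 : measurable_fun [set: Rn R n] u2)
  (u10 : forall x, 0 <= u1 x) (u20 : forall x, 0 <= u2 x)
  (KE : weight_const s q1 q2 r1 r2 u1 u2 = K%:E).

Let q10 : 0 < q1. Proof. exact: lt_trans rq1. Qed.
Let q20 : 0 < q2. Proof. exact: lt_trans rq2. Qed.

(** The weight v = u1^(s/q1) u2^(s/q2). *)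
Definition product_weight (x : Rn R n) : R := u1 x `^ (s / q1) * u2 x `^ (s / q2).
Local Notation v := product_weight.
Local Notation sg1 := (dual_weight u1 r1 q1).
Local Notation sg2 := (dual_weight u2 r2 q2).
Local Notation d1 := (dual_exponent r1 q1).
Local Notation d2 := (dual_exponent r2 q2).

Lemma measurable_product_weight : measurable_fun [set: Rn R n] v.
Proof. by apply: measurable_funM; exact: measurable_powR_comp. Qed.

Lemma product_weight_ge0 x : 0 <= v x.
Proof. by rewrite mulr_ge0 ?powR_ge0. Qed.

(** The cubes on which nothing degenerates: the three integrals of the testing
    condition are positive and finite, the weights are positive almost
    everywhere, and the testing condition holds as an inequality between
    reals, in terms of integrals instead of averages. *)
Definition regular Q := [/\ measurable Q,
  [/\ (0 < \int[mu]_(x in Q) (v x)%:E < +oo)%E,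
     (0 < \int[mu]_(x in Q) (sg1 x)%:E < +oo)%E &
     (0 < \int[mu]_(x in Q) (sg2 x)%:E < +oo)%E],
  exists2 c : R, 0 < c & mu Q = c%:E,
  {ae mu, forall x, Q x -> 0 < u1 x /\ 0 < u2 x} &
  cube_integral v Q `^ s^-1 * cube_integral sg1 Q `^ d1 * cube_integral sg2 Q `^ d2
    <= K * fine (mu Q) `^ (s^-1 + d1 + d2)].

(** Since 0 * +oo = 0, a finite testing constant says nothing about the dual
    weights on a cube where v vanishes; as soon as v has positive mass, all
    three factors are positive, hence finite. *)
Lemma dyadic_regular Q : dyadic Q -> (0 < \int[mu]_(x in Q) (v x)%:E)%E ->
  regular Q.
Proof.
move=> dQ v0; have [mQ [c c0 Qc]] := dyadic_measure dQ.
have muQ0 : (0 < mu Q)%E by rewrite Qc lte_fin.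
set N1 := neg_power u1 (r1 / (q1 - r1)); set N2 := neg_power u2 (r2 / (q2 - r2)).
have mN u a : measurable_fun [set: Rn R n] u -> measurable_fun Q (neg_power u a).
  by move=> mu'; apply: measurable_funTS; exact: measurable_neg_power.
have N0 u a : measurable_fun [set: Rn R n] u ->
    (0 < \int[mu]_(x in Q) neg_power u a x)%E.
  move=> mu'; apply: integral_gt0 => //; first exact: mN.
    by apply: aeW => x _; exact: neg_power_gt0.
  by move=> x _; rewrite ltW// neg_power_gt0.
have N10 := N0 u1 (r1 / (q1 - r1)) mu1; have N20 := N0 u2 (r2 / (q2 - r2)) mu2.
have avg_gt0 (F : Rn R n -> \bar R) (e : R) :
    (0 < \int[mu]_(x in Q) F x)%E -> (0 < avg Q F `^ e)%E.
  by move=> F0; rewrite poweR_gt0// (avgE _ c0 Qc) mule_gt0// lte_fin invr_gt0.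
have a1 : 0 < r1 / (q1 - r1) by rewrite divr_gt0// subr_gt0.
have a2 : 0 < r2 / (q2 - r2) by rewrite divr_gt0// subr_gt0.
have TK : (avg Q (EFin \o v) `^ s^-1 * avg Q N1 `^ d1 * avg Q N2 `^ d2 <= K%:E)%E.
  rewrite -KE; apply: ereal_sup_ubound; exists Q => //.
  by rewrite !dual_exponentE.
have v1 := avg_gt0 _ s^-1 v0.
have n1 := avg_gt0 _ d1 N10.
have n2 := avg_gt0 _ d2 N20.
have [vn voo2] := mule_gt0_lty (mule_gt0 v1 n1) n2 (le_lt_trans TK (ltry K)).
have [voo n1oo] := mule_gt0_lty v1 n1 vn.
have fin (F : Rn R n -> \bar R) (e : R) : e != 0 ->
    (avg Q F `^ e < +oo -> \int[mu]_(x in Q) F x < +oo)%E.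
  move=> e0 /(lty_poweRy e0); rewrite (avgE _ c0 Qc) !ltey.
  by apply: contra => /eqP ->; rewrite gt0_muley// lte_fin invr_gt0.
have vfin := fin _ _ (lt0r_neq0 _) voo.
have d10 := dual_exponent_gt0 r10 rq1; have d20 := dual_exponent_gt0 r20 rq2.
have N1fin := fin N1 _ (lt0r_neq0 d10) n1oo.
have N2fin := fin N2 _ (lt0r_neq0 d20) voo2.
have {}vfin : (\int[mu]_(x in Q) (v x)%:E < +oo)%E.
  by apply: vfin; rewrite invr_gt0.
have u1pos : {ae mu, forall x, Q x -> 0 < u1 x}.
  apply: filterS (integral_lty_ae mQ (mN u1 _ mu1) _ N1fin).
    by move=> x h Qx; exact: neg_power_lty a1 (u10 x) (h Qx).
  by move=> x _; exact/ltW/neg_power_gt0.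
have u2pos : {ae mu, forall x, Q x -> 0 < u2 x}.
  apply: filterS (integral_lty_ae mQ (mN u2 _ mu2) _ N2fin).
    by move=> x h Qx; exact: neg_power_lty a2 (u20 x) (h Qx).
  by move=> x _; exact/ltW/neg_power_gt0.
have sN1 : (\int[mu]_(x in Q) (sg1 x)%:E <= \int[mu]_(x in Q) N1 x)%E.
  apply: ge0_le_integral_nonmeasurable => x _; first by rewrite lee_fin powR_ge0.
  exact: dual_weight_le.
have sN2 : (\int[mu]_(x in Q) (sg2 x)%:E <= \int[mu]_(x in Q) N2 x)%E.
  apply: ge0_le_integral_nonmeasurable => x _; first by rewrite lee_fin powR_ge0.
  exact: dual_weight_le.
have s1fin := le_lt_trans sN1 N1fin; have s2fin := le_lt_trans sN2 N2fin.
have spos u r q : measurable_fun [set: Rn R n] u ->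
    {ae mu, forall x, Q x -> 0 < u x} ->
    (0 < \int[mu]_(x in Q) (dual_weight u r q x)%:E)%E.
  move=> mu' upos.
  apply: (@integral_gt0 _ _ _ mu Q mQ (EFin \o dual_weight u r q)) => //.
  - by apply/measurable_EFinP/measurable_funTS; exact: measurable_powR_comp.
  - by apply: filterS upos => x h Qx; rewrite lte_fin powR_gt0// h.
  - by move=> x _; rewrite lee_fin powR_ge0.
split.
- exact: mQ.
- split; apply/andP; split; [exact: v0|exact: vfin|exact: (spos _ _ _ mu1 u1pos)
    |exact: s1fin|exact: (spos _ _ _ mu2 u2pos)|exact: s2fin].
- by exists c.
- by apply: filterS2 u1pos u2pos => x h1 h2 Qx; split; [exact: h1|exact: h2].
have vE := cube_integralE product_weight_ge0 vfin.
have s1E := cube_integralE (fun x => powR_ge0 _ _) s1fin.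
have s2E := cube_integralE (fun x => powR_ge0 _ _) s2fin.
have real : (((cube_integral v Q / c) `^ s^-1 * (cube_integral sg1 Q / c) `^ d1 *
    (cube_integral sg2 Q / c) `^ d2)%:E <= K%:E)%E.
  apply: le_trans TK; apply: (@le_trans _ _ (avg Q (EFin \o v) `^ s^-1 *
      avg Q (EFin \o sg1) `^ d1 * avg Q (EFin \o sg2) `^ d2)%E).
    have eV := @avg_EFin Q c _ (EFin \o v) s^-1 c0 Qc vE.
    have e1 := @avg_EFin Q c _ (EFin \o sg1) d1 c0 Qc s1E.
    have e2 := @avg_EFin Q c _ (EFin \o sg2) d2 c0 Qc s2E.
    have e := f_equal2 mule (f_equal2 mule eV e1) e2.
    by move: e => ->.
  have mono (F G : Rn R n -> \bar R) e : 0 < e ->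
      (0 <= \int[mu]_(x in Q) F x <= \int[mu]_(x in Q) G x)%E ->
      (avg Q F `^ e <= avg Q G `^ e)%E.
    move=> e0 /andP[F0 FG]; apply: lee_poweR; rewrite ?(ltW e0)//.
      by rewrite (avgE _ c0 Qc) mule_ge0// lee_fin invr_ge0 ltW.
    by rewrite !(avgE _ c0 Qc) lee_wpmul2l// lee_fin invr_ge0 ltW.
  rewrite !lee_pmul ?mule_ge0 ?poweR_ge0//.
    apply: mono => //; rewrite sN1 andbT integral_ge0// => x _.
    by rewrite lee_fin powR_ge0.
  apply: mono => //; rewrite sN2 andbT integral_ge0// => x _.
  by rewrite lee_fin powR_ge0.
rewrite Qc /=; move: real; rewrite lee_fin => real.
have V0 := cube_integral_ge0 Q product_weight_ge0.
have S10 : 0 <= cube_integral sg1 Q by apply: cube_integral_ge0 => x; exact: powR_ge0.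
have S20 : 0 <= cube_integral sg2 Q by apply: cube_integral_ge0 => x; exact: powR_ge0.
exact: average_product_le.
Qed.

End regular_cubes.

Lemma unit_factorization (s q1 q2 r1 r2 a b : R)
    (kappa := (s^-1 + dual_exponent r1 q1 + dual_exponent r2 q2)^-1) :
  0 < s -> 0 < r1 -> r1 < q1 -> 0 < r2 -> r2 < q2 -> 0 < a -> 0 < b ->
  1 = (a `^ (s / q1) * b `^ (s / q2)) `^ (kappa * s^-1) *
    (a `^ (- (r1 / (q1 - r1)))) `^ (kappa * dual_exponent r1 q1) *
    (b `^ (- (r2 / (q2 - r2)))) `^ (kappa * dual_exponent r2 q2).
Proof.
move=> s0 r10 rq1 r20 rq2 /lnK <- /lnK <-.
have q10 := lt_trans r10 rq1; have q20 := lt_trans r20 rq2.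
rewrite -!(expRM, expRD) -[1]expR0; congr expR.
move: kappa => k; rewrite /dual_exponent; field.
by rewrite !subr_eq0 !gt_eqF.
Qed.

Lemma dual_factorization (r q a b : R) : 0 < r -> r < q -> 0 < a -> 0 <= b ->
  b `^ r = (b `^ q * a) `^ (r / q) * (a `^ (- (r / (q - r)))) `^ (1 - r / q).
Proof.
move=> r0 rq a0; have q0 := lt_trans r0 rq.
rewrite le_eqVlt => /predU1P[<-|b0].
  by rewrite !powR0 ?gt_eqF// mul0r powR0 ?mul0r// gt_eqF// divr_gt0.
move: a b a0 b0 => a b /lnK <- /lnK <-.
rewrite -!(expRM, expRD); congr expR; field.
by rewrite subr_eq0 !gt_eqF.
Qed.

Section regular_cube_holder.
Variables (s q1 q2 r1 r2 K : R) (u1 u2 : Rn R n -> R).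
Hypotheses (s0 : 0 < s) (r10 : 0 < r1) (rq1 : r1 < q1) (r20 : 0 < r2)
  (rq2 : r2 < q2) (mu1 : measurable_fun [set: Rn R n] u1)
  (mu2 : measurable_fun [set: Rn R n] u2).
Local Notation v := (product_weight s q1 q2 u1 u2).
Local Notation sg1 := (dual_weight u1 r1 q1).
Local Notation sg2 := (dual_weight u2 r2 q2).
Local Notation d1 := (dual_exponent r1 q1).
Local Notation d2 := (dual_exponent r2 q2).
Local Notation kappa := (s^-1 + d1 + d2)^-1.
Local Notation regular := (regular s q1 q2 r1 r2 K u1 u2).

(** Hölder's inequality for the constant function 1, which is a product of
    powers of v, sigma_1 and sigma_2. *)
Lemma measure_le_testing Q : regular Q ->
  fine (mu Q) <= cube_integral v Q `^ (kappa * s^-1) *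
    cube_integral sg1 Q `^ (kappa * d1) * cube_integral sg2 Q `^ (kappa * d2).
Proof.
move=> [mQ [Vf S1f S2f] [c c0 Qc] upos _].
have [V0 VE] := fin_integral_pos (@product_weight_ge0 s q1 q2 u1 u2) Vf.
have [S10 S1E] := fin_integral_pos (fun x => powR_ge0 _ _) S1f.
have [S20 S2E] := fin_integral_pos (fun x => powR_ge0 _ _) S2f.
have d10 := dual_exponent_gt0 r10 rq1; have d20 := dual_exponent_gt0 r20 rq2.
have si0 : 0 < s^-1 by rewrite invr_gt0.
have sum0 := addr_gt0 (addr_gt0 si0 d10) d20.
have k0 : 0 < kappa by rewrite invr_gt0.
have k1 : kappa * s^-1 + kappa * d1 + kappa * d2 = 1.
  by rewrite -!mulrDr mulVf// gt_eqF.
have := @integral_holder3 _ _ R mu Q mQ (fun=> 1) v sg1 sg2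
  (kappa * s^-1) (kappa * d1) (kappa * d2) _ _ _
  (ltW (mulr_gt0 k0 si0)) (ltW (mulr_gt0 k0 d10)) (ltW (mulr_gt0 k0 d20)) k1
  V0 S10 S20.
have -> : (\int[mu]_(t in Q) 1%:E = (fine (mu Q))%:E)%E.
  by rewrite integral_cst// mul1e Qc.
rewrite lee_fin; apply.
- exact: measurable_cst.
- by apply: measurable_funTS; exact: measurable_product_weight.
- by apply: measurable_funTS; exact: measurable_powR_comp.
- by apply: measurable_funTS; exact: measurable_powR_comp.
- by [].
- exact: product_weight_ge0.
- by move=> x; exact: powR_ge0.
- by move=> x; exact: powR_ge0.
- apply: filterS upos => x h Qx; have [a b] := h Qx.
  by rewrite {1}(unit_factorization s0 r10 rq1 r20 rq2 a b).
- by rewrite VE; exact: le_refl.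
- by rewrite S1E; exact: le_refl.
- by rewrite S2E; exact: le_refl.
Qed.

End regular_cube_holder.

(** Hölder's inequality for |f|^r = (|f|^q u)^(r/q) (u^(-r/(q-r)))^(1-r/q). *)
Lemma dual_holder Q (c r q : R) u f : 0 < r -> r < q -> measurable Q ->
  0 < c -> mu Q = c%:E ->
  measurable_fun [set: Rn R n] u -> measurable_fun [set: Rn R n] f ->
  (forall x, 0 <= u x) -> {ae mu, forall x, Q x -> 0 < u x} ->
  (0 < \int[mu]_(x in Q) (dual_weight u r q x)%:E < +oo)%E ->
  (\int[mu]_(x in Q) (`|f x| `^ q * u x)%:E < +oo)%E ->
  (\int[mu]_(x in Q) (`|f x| `^ r)%:E < +oo)%E /\
  cube_integral (fun x => `|f x| `^ r) Q `^ (q / r) *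
    cube_integral (dual_weight u r q) Q `^ (1 - q / r) <=
  cube_integral (fun x => `|f x| `^ q * u x) Q.
Proof.
move=> r0 rq mQ c0 Qc mu' mf u0 upos Sf Jf; have q0 := lt_trans r0 rq.
have [S0 SE] := fin_integral_pos (fun x => powR_ge0 _ _) Sf.
have Jge0 x : 0 <= `|f x| `^ q * u x by rewrite mulr_ge0 ?powR_ge0.
have JE := cube_integralE Jge0 Jf.
have J0 := cube_integral_ge0 Q Jge0.
have mabs e : measurable_fun [set: Rn R n] (fun x => `|f x| `^ e).
  by apply: measurable_powR_comp; exact: measurableT_comp.
have a0 : 0 < r / q by rewrite divr_gt0.
have a1 : 0 < 1 - r / q by rewrite subr_gt0 ltr_pdivrMr// mul1r.
have cE : (\int[mu]_(t in Q) 1%:E = c%:E)%E.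
  by rewrite integral_cst// mul1e; exact: Qc.
(* the integral of |f|^q u may be zero, so it is enlarged by e *)
have bound e : 0 < e -> (\int[mu]_(x in Q) (`|f x| `^ r)%:E <=
    ((cube_integral (fun x => `|f x| `^ q * u x) Q + e) `^ (r / q) *
     cube_integral (dual_weight u r q) Q `^ (1 - r / q))%:E)%E.
  move=> e0.
  have := @integral_holder3 _ _ R mu Q mQ (fun x => `|f x| `^ r)
    (fun x => `|f x| `^ q * u x) (dual_weight u r q) (fun=> 1)
    (r / q) (1 - r / q) 0 (cube_integral (fun x => `|f x| `^ q * u x) Q + e)
    (cube_integral (dual_weight u r q) Q) c (ltW a0) (ltW a1) (lexx _).
  rewrite !powRr0 mulr1; apply.
  - by rewrite addr0 subrKC.
  - by rewrite ltr_wpDl.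
  - exact: S0.
  - exact: c0.
  - by apply: measurable_funTS.
  - by apply: measurable_funTS; exact: measurable_funM.
  - by apply: measurable_funTS; exact: measurable_powR_comp.
  - exact: measurable_cst.
  - by move=> x; exact: powR_ge0.
  - exact: Jge0.
  - by move=> x; exact: powR_ge0.
  - by [].
  - apply: filterS upos => x h Qx.
    by rewrite mulr1 -(dual_factorization r0 rq (h Qx) (normr_ge0 (f x))).
  - by rewrite JE lee_fin lerDl ltW.
  - by rewrite SE.
  - by rewrite cE.
have fin : (\int[mu]_(x in Q) (`|f x| `^ r)%:E < +oo)%E.
  exact: le_lt_trans (bound 1 ltr01) (ltry _).
split=> //; apply/ler_addgt0Pr => e e0.
have := bound e e0; rewrite (cube_integralE _ fin); last first.
  by move=> x; exact: powR_ge0.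
have X0 := cube_integral_ge0 Q (fun x => powR_ge0 `|f x| r); rewrite lee_fin => h.
exact: (holder_solve r0 rq X0 S0 (ltr_wpDl J0 e0) h).
Qed.

Lemma jensen_power Q (c s t : R) (F : Rn R n -> R) : 0 < t -> t <= s ->
  measurable Q -> 0 < c -> mu Q = c%:E -> measurable_fun [set: Rn R n] F ->
  (forall x, 0 <= F x) -> (0 < \int[mu]_(x in Q) (F x)%:E < +oo)%E ->
  (\int[mu]_(x in Q) (F x `^ (t / s))%:E <=
   (cube_integral F Q `^ (t / s) * c `^ (1 - t / s))%:E)%E.
Proof.
move=> t0 ts mQ c0 Qc mF F0 Ff; have s0 := lt_le_trans t0 ts.
have cE : (\int[mu]_(t in Q) 1%:E = c%:E)%E.
  by rewrite integral_cst// mul1e; exact: Qc.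
have [I0 IE] := fin_integral_pos F0 Ff.
have a0 : 0 <= t / s by rewrite divr_ge0// ltW.
have a1 : 0 <= 1 - t / s by rewrite subr_ge0 ler_pdivrMr// mul1r.
have := @integral_holder3 _ _ R mu Q mQ (fun x => F x `^ (t / s))
  F (fun=> 1) (fun=> 1) (t / s) (1 - t / s) 0 (cube_integral F Q) c c a0 a1 (lexx _).
rewrite !powRr0 mulr1; apply.
- by rewrite addr0 subrKC.
- exact: I0.
- exact: c0.
- exact: c0.
- by apply: measurable_funTS; exact: measurable_powR_comp.
- exact: measurable_funTS.
- exact: measurable_cst.
- exact: measurable_cst.
- by move=> x; exact: powR_ge0.
- exact: F0.
- by [].
- by [].
- by apply: aeW => x _; rewrite powR1 !mulr1.
- by rewrite IE.
- by rewrite cE.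
- by rewrite cE.
Qed.

Lemma vanishing_average Q (r q' : R) (u h : Rn R n -> R) : 0 < r -> r < q' ->
  measurable Q -> (exists2 c : R, 0 < c & mu Q = c%:E) ->
  measurable_fun [set: Rn R n] u -> measurable_fun [set: Rn R n] h ->
  (forall x, 0 <= u x) -> {ae mu, forall x, Q x -> 0 < u x} ->
  (0 < \int[mu]_(x in Q) (dual_weight u r q' x)%:E < +oo)%E ->
  (\int[mu]_(x in Q) (`|h x| `^ q' * u x)%:E = 0)%E ->
  (\int[mu]_(x in Q) (`|h x| `^ r)%:E = 0)%E.
Proof.
move=> r0 rq mQ [c c0 Qc] mu' mh u0 upos Sf J0.
have Jf : (\int[mu]_(x in Q) (`|h x| `^ q' * u x)%:E < +oo)%E by rewrite J0 ltry.
have [Xf X] := dual_holder r0 rq mQ c0 Qc mu' mh u0 upos Sf Jf.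
have X0 x : 0 <= `|h x| `^ r by exact: powR_ge0.
rewrite (cube_integralE X0 Xf); congr EFin; apply/eqP.
have [S0 _] := fin_integral_pos (fun x => powR_ge0 _ _) Sf.
have : cube_integral (fun x => `|h x| `^ r) Q `^ (q' / r) == 0.
  rewrite eq_le powR_ge0 andbT -(ler_pM2r (powR_gt0 (1 - q' / r) S0)) mul0r.
  by apply: (le_trans X); rewrite /cube_integral J0.
by rewrite powR_eq0 => /andP[].
Qed.

Lemma morrey_term_le Q (c A s t : R) (F : Rn R n -> \bar R) :
  0 < c -> lebesgue Q = c%:E -> 0 < t -> (forall x, 0 <= F x)%E ->
  (\int[lebesgue]_(x in Q) F x <= A%:E)%E ->
  (lebesgue Q `^ s^-1 * avg Q F `^ t^-1 <= (c `^ s^-1 * (c^-1 * A) `^ t^-1)%:E)%E.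
Proof.
move=> c0 Qc t0 F0 FA; rewrite (avgE F c0 Qc) [X in (X `^ _ * _)%E]Qc poweR_EFin EFinM.
apply: lee_wpmul2l; first by rewrite lee_fin powR_ge0.
rewrite -poweR_EFin; apply: lee_poweR; first by rewrite invr_ge0 ltW.
  by rewrite mule_ge0 ?lee_fin ?invr_ge0 ?(ltW c0)// integral_ge0.
by rewrite EFinM; apply: lee_wpmul2l => //; rewrite lee_fin invr_ge0 ltW.
Qed.

End cubes.

(** * The maximal operator on one cube *)

Section local_estimate.
Context {R : realType} {n : nat}.
Local Notation mu := (@lebesgue R n).
Variables alpha p q t s q1 q2 r1 r2 K N : R.
Variables u1 u2 f g : Rn R n -> R.
Local Notation al := (alpha / n%:R).
Hypotheses (al0 : 0 <= al) (q0 : 0 < q) (qp : q <= p) (t0 : 0 < t) (ts : t <= s)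
  (r10 : 0 < r1) (rq1 : r1 < q1) (r20 : 0 < r2) (rq2 : r2 < q2)
  (hq : q^-1 = q1^-1 + q2^-1) (hs : s^-1 = p^-1 - al) (hts : t / s = q / p).
Hypotheses (mu1 : measurable_fun [set: Rn R n] u1)
  (mu2 : measurable_fun [set: Rn R n] u2)
  (u10 : forall x, 0 <= u1 x) (u20 : forall x, 0 <= u2 x)
  (mf : measurable_fun [set: Rn R n] f) (mg : measurable_fun [set: Rn R n] g)
  (KE : weight_const s q1 q2 r1 r2 u1 u2 = K%:E) (K0 : 0 <= K)
  (NE : weighted_morrey_product p q1 q2 u1 u2 f g = N%:E).
Local Notation v := (product_weight s q1 q2 u1 u2).
Local Notation sg1 := (dual_weight u1 r1 q1).
Local Notation sg2 := (dual_weight u2 r2 q2).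
Local Notation fr := (fun x => `|f x| `^ r1).
Local Notation gr := (fun x => `|g x| `^ r2).
Local Notation fq := (fun x => `|f x| `^ q1 * u1 x).
Local Notation gq := (fun x => `|g x| `^ q2 * u2 x).
Local Notation d1 := (dual_exponent r1 q1).
Local Notation d2 := (dual_exponent r2 q2).
Local Notation regular := (regular s q1 q2 r1 r2 K u1 u2).
Local Notation I := cube_integral.
Local Notation fa := (fractional_average al r1 r2).

Let s0 : 0 < s. Proof. exact: lt_le_trans ts. Qed.
Let q10 : 0 < q1. Proof. exact: lt_trans rq1. Qed.
Let q20 : 0 < q2. Proof. exact: lt_trans rq2. Qed.
Let fr0 x : 0 <= fr x. Proof. exact: powR_ge0. Qed.
Let gr0 x : 0 <= gr x. Proof. exact: powR_ge0. Qed.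
Let fq0 x : 0 <= fq x. Proof. by rewrite mulr_ge0 ?powR_ge0. Qed.
Let gq0 x : 0 <= gq x. Proof. by rewrite mulr_ge0 ?powR_ge0. Qed.

(** The term of Q in the supremum that defines the maximal function. *)
Definition maximal_term (Q : set (Rn R n)) : \bar R := (mu Q `^ al
  * avg Q (fun y => (fr y)%:E) `^ r1^-1 * avg Q (fun y => (gr y)%:E) `^ r2^-1)%E.

Lemma maximal_term_ge0 Q : (0 <= maximal_term Q)%E.
Proof. by rewrite !mule_ge0 ?poweR_ge0. Qed.

Lemma maximal_term_eq0 Q c : 0 < c -> mu Q = c%:E ->
  (\int[mu]_(x in Q) (fr x)%:E = 0)%E \/ (\int[mu]_(x in Q) (gr x)%:E = 0)%E ->
  maximal_term Q = 0%E.
Proof.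
move=> c0 Qc [FE|FE]; rewrite /maximal_term.
  rewrite (avgE _ c0 Qc) FE mule0 poweR0r ?mule0 ?mul0e// gt_eqF// invr_gt0//.
rewrite [X in (_ * X)%E](_ : _ = 0%E) ?mule0//.
by rewrite (avgE _ c0 Qc) FE mule0 poweR0r// gt_eqF// invr_gt0.
Qed.

Lemma maximal_termE Q c X1 X2 : 0 < c -> mu Q = c%:E ->
  (\int[mu]_(x in Q) (fr x)%:E = X1%:E)%E -> (\int[mu]_(x in Q) (gr x)%:E = X2%:E)%E ->
  maximal_term Q = (fa c X1 X2)%:E.
Proof.
move=> c0 Qc FE GE.
have e1 := @avg_EFin R n Q c X1 (fun y => (fr y)%:E) r1^-1 c0 Qc FE.
have e2 := @avg_EFin R n Q c X2 (fun y => (gr y)%:E) r2^-1 c0 Qc GE.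
have e0 : (mu Q `^ al = (c `^ al)%:E)%E by rewrite Qc poweR_EFin.
exact: (f_equal2 mule (f_equal2 mule e0 e1) e2).
Qed.

(** The Morrey condition on Q, in terms of integrals instead of averages. *)
Lemma morrey_bound Q c J1 J2 : dyadic Q -> 0 < c -> mu Q = c%:E ->
  0 <= J1 -> 0 <= J2 ->
  (\int[mu]_(x in Q) (fq x)%:E = J1%:E)%E -> (\int[mu]_(x in Q) (gq x)%:E = J2%:E)%E ->
  c `^ (p^-1 - q^-1) * J1 `^ q1^-1 * J2 `^ q2^-1 <= N.
Proof.
move=> dQ c0 Qc J10 J20 FE GE.
have e1 := @avg_EFin R n Q c J1 (fun y => (fq y)%:E) q1^-1 c0 Qc FE.
have e2 := @avg_EFin R n Q c J2 (fun y => (gq y)%:E) q2^-1 c0 Qc GE.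
have e0 : (mu Q `^ p^-1 = (c `^ p^-1)%:E)%E by rewrite Qc poweR_EFin.
have e := f_equal2 mule (f_equal2 mule e0 e1) e2.
have : (weighted_morrey_product p q1 q2 u1 u2 f g <= N%:E)%E by rewrite NE.
move=> h; have {}h := le_trans (ereal_sup_ubound _) h.
have {h} : (c `^ p^-1 * (J1 / c) `^ q1^-1 * (J2 / c) `^ q2^-1 <= N).
  by rewrite -lee_fin; apply: h; exists Q.
apply: le_trans; rewrite le_eqVlt; apply/orP; left; apply/eqP.
have cE e' : c^-1 `^ e' = c `^ (- e').
  by rewrite -[c^-1]powR_inv1 ?(ltW c0)// -powRrM mulN1r.
rewrite !powRM ?invr_ge0 ?(ltW c0)// !cE.
have -> : p^-1 - q^-1 = p^-1 + - q1^-1 + - q2^-1 by rewrite hq opprD addrA.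
by rewrite !(@powRD _ c) ?(gt_eqF c0) ?implybT//; ring.
Qed.

(** If one integral in a finite Morrey product is infinite, the other one is
    zero. *)
Lemma factor_eq0 (I1 I2 : \bar R) (c e1 e2 M : R) : 0 < c -> 0 < e1 -> 0 < e2 ->
  (0 <= I2)%E -> I1 = +oo%E ->
  (((c `^ p^-1)%:E * (c^-1%:E * I1) `^ e1) * (c^-1%:E * I2) `^ e2 <= M%:E)%E ->
  I2 = 0%E.
Proof.
move=> c0 e10 e20 I20 ->.
have ci : 0 < c^-1 by rewrite invr_gt0.
rewrite mulry gtr0_sg// mul1e poweRyr ?gt_eqF// mulry gtr0_sg ?powR_gt0// mul1e.
move: I20; rewrite le_eqVlt => /predU1P[//|I20].
by rewrite gt0_mulye ?poweR_gt0 ?mule_gt0// leye_eq.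
Qed.

(** On a regular cube either both weighted integrals are finite, or one of them
    is infinite, so that the other function vanishes almost everywhere and the
    term of the cube is 0 by the convention 0 * +oo = 0. *)
Lemma cube_dichotomy Q : dyadic Q -> regular Q ->
  ((\int[mu]_(x in Q) (fr x)%:E = 0)%E \/ (\int[mu]_(x in Q) (gr x)%:E = 0)%E) \/
  ((\int[mu]_(x in Q) (fq x)%:E < +oo)%E /\ (\int[mu]_(x in Q) (gq x)%:E < +oo)%E).
Proof.
move=> dQ [mQ [_ S1f S2f] cQ upos _]; have [c c0 Qc] := cQ.
have u1pos : {ae mu, forall x, Q x -> 0 < u1 x}.
  by apply: filterS upos => x h Qx; have [] := h Qx.
have u2pos : {ae mu, forall x, Q x -> 0 < u2 x}.
  by apply: filterS upos => x h Qx; have [] := h Qx.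
have J10 : (0 <= \int[mu]_(x in Q) (fq x)%:E)%E.
  by apply: integral_ge0 => x _; rewrite lee_fin.
have J20 : (0 <= \int[mu]_(x in Q) (gq x)%:E)%E.
  by apply: integral_ge0 => x _; rewrite lee_fin.
have bound : (((c `^ p^-1)%:E * (c^-1%:E * \int[mu]_(x in Q) (fq x)%:E) `^ q1^-1)
    * (c^-1%:E * \int[mu]_(x in Q) (gq x)%:E) `^ q2^-1 <= N%:E)%E.
  have e0 : (mu Q `^ p^-1 = (c `^ p^-1)%:E)%E by rewrite Qc poweR_EFin.
  have e1 := congr1 (fun y => y `^ q1^-1)%E (@avgE R n Q c (fun y => (fq y)%:E) c0 Qc).
  have e2 := congr1 (fun y => y `^ q2^-1)%E (@avgE R n Q c (fun y => (gq y)%:E) c0 Qc).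
  have e := f_equal2 mule (f_equal2 mule e0 e1) e2.
  have : (weighted_morrey_product p q1 q2 u1 u2 f g <= N%:E)%E by rewrite NE.
  move=> h; apply: le_trans h; apply: ereal_sup_ubound; exists Q => //.
have q1i : 0 < q1^-1 by rewrite invr_gt0.
have q2i : 0 < q2^-1 by rewrite invr_gt0.
have [J1oo|J1oo] := eqVneq (\int[mu]_(x in Q) (fq x)%:E)%E +oo%E.
  left; right; apply: (vanishing_average r20 rq2 mQ cQ mu2 mg u20 u2pos S2f).
  exact: (factor_eq0 c0 q1i q2i J20 J1oo bound).
have [J2oo|J2oo] := eqVneq (\int[mu]_(x in Q) (gq x)%:E)%E +oo%E.
  left; left; apply: (vanishing_average r10 rq1 mQ cQ mu1 mf u10 u1pos S1f).
  apply: (@factor_eq0 (\int[mu]_(x in Q) (gq x)%:E)%E _ c q2^-1 q1^-1 N c0 q2i q1i J10 J2oo).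
  by rewrite -muleA [X in (_ * X)%E]muleC muleA.
by right; rewrite !ltey.
Qed.

Lemma morrey_product_ge0 (Q : set (Rn R n)) : dyadic Q -> 0 <= N.
Proof.
move=> dQ; rewrite -lee_fin -NE.
apply: (@le_trans _ _ (mu Q `^ p^-1 * avg Q (fun x => (fq x)%:E) `^ q1^-1
    * avg Q (fun x => (gq x)%:E) `^ q2^-1)%E).
  by rewrite !mule_ge0 ?poweR_ge0.
by apply: ereal_sup_ubound; exists Q.
Qed.

Lemma finite_cube Q : dyadic Q -> regular Q ->
  (\int[mu]_(x in Q) (fq x)%:E < +oo)%E -> (\int[mu]_(x in Q) (gq x)%:E < +oo)%E ->
  [/\ (\int[mu]_(x in Q) (fr x)%:E < +oo)%E, (\int[mu]_(x in Q) (gr x)%:E < +oo)%E,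
   I fr Q `^ (q1 / r1) * I sg1 Q `^ (1 - q1 / r1) <= I fq Q,
   I gr Q `^ (q2 / r2) * I sg2 Q `^ (1 - q2 / r2) <= I gq Q &
   fine (mu Q) `^ (p^-1 - q^-1) * I fq Q `^ q1^-1 * I gq Q `^ q2^-1 <= N].
Proof.
move=> dQ [mQ [_ S1f S2f] [c c0 Qc] upos _] Jf Jg.
have u1pos : {ae mu, forall x, Q x -> 0 < u1 x}.
  by apply: filterS upos => x h Qx; have [] := h Qx.
have u2pos : {ae mu, forall x, Q x -> 0 < u2 x}.
  by apply: filterS upos => x h Qx; have [] := h Qx.
have [X1f X1] := dual_holder r10 rq1 mQ c0 Qc mu1 mf u10 u1pos S1f Jf.
have [X2f X2] := dual_holder r20 rq2 mQ c0 Qc mu2 mg u20 u2pos S2f Jg.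
split => //; have -> : fine (mu Q) = c by rewrite Qc.
have JE1 := cube_integralE fq0 Jf; have JE2 := cube_integralE gq0 Jg.
exact: (morrey_bound dQ c0 Qc (cube_integral_ge0 Q fq0) (cube_integral_ge0 Q gq0) JE1 JE2).
Qed.

Lemma fractional_average_le (c V S1 S2 X1 X2 J1 J2 : R) :
  0 < c -> 0 < V -> 0 < S1 -> 0 < S2 -> 0 < X1 -> 0 < X2 ->
  V `^ s^-1 * S1 `^ d1 * S2 `^ d2 <= K * c `^ (s^-1 + d1 + d2) ->
  X1 `^ (q1 / r1) * S1 `^ (1 - q1 / r1) <= J1 ->
  X2 `^ (q2 / r2) * S2 `^ (1 - q2 / r2) <= J2 ->
  c `^ (p^-1 - q^-1) * J1 `^ q1^-1 * J2 `^ q2^-1 <= N ->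
  fa c X1 X2 <= K * N * V `^ (- s^-1).
Proof.
move=> c0 V0 S10 S20 X10 X20 hK h1 h2 hN.
rewrite powRN ler_pdivlMr ?powR_gt0//.
apply: le_trans (fractional_average_testing q0 qp r10 rq1 r20 rq2 hq hs
  c0 V0 S10 S20 X10 X20 K0 hK) _.
rewrite ler_wpM2l//; apply: le_trans hN.
rewrite -(energyE _ S10 (ltW X10)) in h1; rewrite -(energyE _ S20 (ltW X20)) in h2.
have A10 : 0 <= S1 * (X1 / S1) `^ (q1 / r1) by rewrite mulr_ge0 ?powR_ge0 ?ltW.
have A20 : 0 <= S2 * (X2 / S2) `^ (q2 / r2) by rewrite mulr_ge0 ?powR_ge0 ?ltW.
rewrite !ler_pM ?mulr_ge0 ?powR_ge0//.
  by rewrite ge0_ler_powR ?invr_ge0 ?nnegrE ?(ltW q10)// (le_trans A10).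
by rewrite ge0_ler_powR ?invr_ge0 ?nnegrE ?(ltW q20)// (le_trans A20).
Qed.

(** This bound is used for the cubes that contain the given one. *)
Lemma large_cube_term Q : dyadic Q -> regular Q ->
  (maximal_term Q <= (K * N * I v Q `^ (- s^-1))%:E)%E.
Proof.
move=> dQ rQ; have [mQ [Vf S1f S2f] [c c0 Qc] upos testing] := rQ.
have RHS0 : (0%:E <= (K * N * I v Q `^ (- s^-1))%:E)%E.
  by rewrite lee_fin !mulr_ge0 ?powR_ge0// (morrey_product_ge0 dQ).
have [X0|[Jf Jg]] := cube_dichotomy dQ rQ; first by rewrite (maximal_term_eq0 c0 Qc X0).
have [X1f X2f h1 h2 hN] := finite_cube dQ rQ Jf Jg.
have FE := cube_integralE fr0 X1f; have GE := cube_integralE gr0 X2f.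
have := cube_integral_ge0 Q fr0; rewrite le_eqVlt => /predU1P[X10|X10].
  by rewrite (maximal_term_eq0 c0 Qc)//; left; rewrite FE -X10.
have := cube_integral_ge0 Q gr0; rewrite le_eqVlt => /predU1P[X20|X20].
  by rewrite (maximal_term_eq0 c0 Qc)//; right; rewrite GE -X20.
have [V0 _] := fin_integral_pos (@product_weight_ge0 R n s q1 q2 u1 u2) Vf.
have [S10 _] := fin_integral_pos (fun x => powR_ge0 _ _) S1f.
have [S20 _] := fin_integral_pos (fun x => powR_ge0 _ _) S2f.
rewrite (maximal_termE c0 Qc FE GE) lee_fin.
rewrite Qc /= in testing hN.
exact: (fractional_average_le c0 V0 S10 S20 X10 X20 testing h1 h2 hN).
Qed.

Section descendants_of_a_cube.
Variables (k : int) (m : 'I_n -> int).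
Local Notation D := (@dyadic_descendant R n k m).
Local Notation word := (seq {ffun 'I_n -> bool}).
Hypothesis regular_root : regular (D [::]).

Let dD (w : word) : dyadic (D w). Proof. by eexists; eexists. Qed.
Let mD (w : word) : measurable (D w).
Proof. exact: measurable_dyadic_descendant. Qed.
Let D_sub (w : word) : D w `<=` D [::].
Proof.
move=> x /dyadic_descendant_root; by rewrite /dyadic_descendant /= addr0.
Qed.

Lemma regular_descendant w : regular (D w).
Proof.
have [_ _ _ upos _] := regular_root.
apply: (dyadic_regular s0 r10 rq1 r20 rq2 mu1 mu2 u10 u20 KE (dD w)).
have [_ [c c0 Dc]] := dyadic_measure (dD w).
have muD0 : (0 < mu (D w))%E by rewrite Dc lte_fin.
apply: (@integral_gt0 _ _ _ mu (D w) (mD w) (EFin \o v)).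
- by apply/measurable_EFinP/measurable_funTS; exact: measurable_product_weight.
- apply: filterS upos => x h Dx; have [a b] := h (D_sub Dx).
  by rewrite lte_fin mulr_gt0 ?powR_gt0.
- by move=> x _; rewrite lee_fin product_weight_ge0.
- exact: muD0.
Qed.

Lemma integral_descendant_le w (F : Rn R n -> R) :
  measurable_fun [set: Rn R n] F -> (forall x, 0 <= F x) ->
  (\int[mu]_(x in D w) (F x)%:E <= \int[mu]_(x in D [::]) (F x)%:E)%E.
Proof.
move=> mF F0; apply: ge0_subset_integral; [exact: mD|exact: mD| | |exact: D_sub].
  by apply/measurable_EFinP; exact: measurable_funTS.
by move=> x _; rewrite lee_fin.
Qed.

Lemma cube_integral_additive (F : Rn R n -> R) :
  measurable_fun [set: Rn R n] F -> (forall x, 0 <= F x) ->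
  (\int[mu]_(x in D [::]) (F x)%:E < +oo)%E ->
  tree_additive (fun w => I F (D w)).
Proof.
move=> mF F0 Foo w; rewrite /cube_integral.
rewrite (@integral_dyadic_descendant R n k m w (EFin \o F)).
- rewrite -sum_fine// => e _; rewrite ge0_fin_numE.
    exact: le_lt_trans (integral_descendant_le _ mF F0) Foo.
  by apply: integral_ge0 => x _; rewrite lee_fin.
- exact/measurable_EFinP.
- by move=> x; rewrite lee_fin.
Qed.

Lemma indicator_integral w (c : R) (F : Rn R n -> R) :
  0 <= c -> measurable_fun [set: Rn R n] F -> (forall x, 0 <= F x) ->
  (\int[mu]_(x in D [::]) (c * \1_(D w) x * F x)%:E =
   c%:E * \int[mu]_(x in D w) (F x)%:E)%E.
Proof.
move=> c0 mF F0.
rewrite -[in RHS](setIidr (@D_sub w)) integral_mkcondr -ge0_integralZl_EFin//.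
- apply: eq_integral => x _; rewrite patchE indicE.
  by case: ifPn => xw; rewrite ?mulr1 ?mulr0 ?mul0r ?mule0// EFinM.
- by move=> x _; rewrite patchE; case: ifP => // _; rewrite lee_fin.
- apply: measurable_funTS; apply/(measurable_restrictT _ (mD w)).1.
  by apply: measurable_funTS; exact/measurable_EFinP.
Qed.

Lemma stopping_ancestor_sub (mw X1 X2 : word -> R) w :
  D w `<=` D (stopping_ancestor mw X1 X2 w).
Proof.
elim: w => [//|b w IH]; rewrite [stopping_ancestor _ _ _ _]/=.
case: ifP => _; first exact: subset_refl.
move=> x xD; apply: IH.
exact: ((dyadic_descendant_cons k m w x).2 (ex_intro _ b xD)).
Qed.

(** An increasing sequence of functions that eventually dominates the t-th
    power of the term of every descendant, and whose integrals against
    v^(t/s) are uniformly bounded. *)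
Definition small_cube_majorant (G : nat -> Rn R n -> R) : Prop :=
  [/\ forall M, measurable_fun [set: Rn R n] (G M),
    forall M x, 0 <= G M x,
    forall x, {homo G^~ x : M M' / (M <= M')%N >-> M <= M'},
    forall w x, D w x -> exists2 a, 0 <= a &
      (maximal_term (D w) <= a%:E)%E /\ exists M, a `^ t <= G M x &
    forall M, (\int[mu]_(x in D [::]) (G M x * v x `^ (t / s))%:E <=
      ((4 `^ (r1^-1 + r2^-1)) `^ t * (testing_const q s q1 q2 r1 r2 K
        * (K * N) `^ t * fine (mu (D [::])) `^ (1 - t / s)))%:E)%E].

(** The majorant is the sum over the stopping cubes P of c_P^t on P. *)
Lemma small_cubes : exists G, small_cube_majorant G.
Proof.
have N0 : 0 <= N := morrey_product_ge0 (dD [::]).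
have tc0 : 0 <= testing_const q s q1 q2 r1 r2 K.
  exact: testing_const_ge0.
have mpow (h : Rn R n -> R) e : measurable_fun [set: Rn R n] h ->
    measurable_fun [set: Rn R n] (fun x => `|h x| `^ e).
  by move=> mh; apply: measurable_powR_comp; exact: measurableT_comp.
have mfr : measurable_fun [set: Rn R n] fr := mpow _ _ mf.
have mgr : measurable_fun [set: Rn R n] gr := mpow _ _ mg.
have zero : (\int[mu]_(x in D [::]) (fr x)%:E = 0)%E \/
    (\int[mu]_(x in D [::]) (gr x)%:E = 0)%E ->
    forall w, maximal_term (D w) = 0%E.
  have sub0 (F : Rn R n -> R) w : measurable_fun [set: Rn R n] F ->
      (forall x, 0 <= F x) -> (\int[mu]_(x in D [::]) (F x)%:E = 0)%E ->
      (\int[mu]_(x in D w) (F x)%:E = 0)%E.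
    move=> mF F0 h; apply/eqP; rewrite eq_le integral_ge0 ?andbT; last first.
      by move=> x _; rewrite lee_fin.
    by rewrite -h; exact: integral_descendant_le.
  move=> h w; have [_ [c c0 Dc]] := dyadic_measure (dD w).
  apply: (maximal_term_eq0 c0 Dc); case: h => h; [left|right].
    exact: sub0 mfr fr0 h.
  exact: sub0 mgr gr0 h.
(* if the averages over the root vanish, the zero sequence is a majorant *)
have trivial_case : (forall w, maximal_term (D w) = 0%E) ->
    exists G, small_cube_majorant G.
  move=> z; exists (fun _ _ => 0); split=> //.
  - by move=> x M M' _; exact: lexx.
  - move=> w x _; exists 0 => //; split; first by rewrite z.
    by exists 0%N; rewrite powR0 ?gt_eqF.
  - move=> M; rewrite (_ : (fun x => _) = (fun=> 0%E)); last first.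
      by apply/funext => x; rewrite mul0r.
    by rewrite integral0 lee_fin !mulr_ge0 ?powR_ge0.
have [/zero /trivial_case//|[Jf Jg]] := cube_dichotomy (dD [::]) regular_root.
have [X1f X2f _ _ _] := finite_cube (dD [::]) regular_root Jf Jg.
have := cube_integral_ge0 (D [::]) fr0; rewrite le_eqVlt => /predU1P[X10|X1nil].
  by apply/trivial_case/zero; left; rewrite (cube_integralE fr0 X1f) -X10.
have := cube_integral_ge0 (D [::]) gr0; rewrite le_eqVlt => /predU1P[X20|X2nil].
  by apply/trivial_case/zero; right; rewrite (cube_integralE gr0 X2f) -X20.
have [_ [Vf S1f S2f] _ _ _] := regular_root.
pose mw w := I (fun=> 1) (D w).
have mwE w : mw w = fine (mu (D w)) by rewrite /mw /cube_integral integral_cst// mul1e.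
have mw0 w : 0 < mw w.
  by rewrite mwE; have [_ [c c0 ->]] := dyadic_measure (dD w).
have add (F : Rn R n -> R) : measurable_fun [set: Rn R n] F -> (forall x, 0 <= F x) ->
  (\int[mu]_(x in D [::]) (F x)%:E < +oo)%E -> tree_additive (fun w => I F (D w)).
  exact: cube_integral_additive.
have mfq : measurable_fun [set: Rn R n] fq := measurable_funM (mpow _ _ mf) mu1.
have mgq : measurable_fun [set: Rn R n] gq := measurable_funM (mpow _ _ mg) mu2.
have lty (F : Rn R n -> R) w : measurable_fun [set: Rn R n] F -> (forall x, 0 <= F x) ->
    (\int[mu]_(x in D [::]) (F x)%:E < +oo)%E -> (\int[mu]_(x in D w) (F x)%:E < +oo)%E.
  by move=> mF F0; apply: le_lt_trans; exact: integral_descendant_le.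
have fin w := finite_cube (dD w) (regular_descendant w)
  (lty _ w mfq fq0 Jf) (lty _ w mgq gq0 Jg).
have v0 := @product_weight_ge0 R n s q1 q2 u1 u2.
have sg10 x : 0 <= sg1 x by exact: powR_ge0.
have sg20 x : 0 <= sg2 x by exact: powR_ge0.
have mv := measurable_product_weight s q1 q2 mu1 mu2.
have V0 w : 0 < I v (D w).
  by have [_ [h _ _] _ _ _] := regular_descendant w; have [] := fin_integral_pos v0 h.
have S10 w : 0 < I sg1 (D w).
  by have [_ [_ h _] _ _ _] := regular_descendant w; have [] := fin_integral_pos sg10 h.
have S20 w : 0 < I sg2 (D w).
  by have [_ [_ _ h] _ _ _] := regular_descendant w; have [] := fin_integral_pos sg20 h.
pose X1 w := I fr (D w); pose X2 w := I gr (D w).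
have X10 w : 0 <= X1 w by exact: cube_integral_ge0.
have X20 w : 0 <= X2 w by exact: cube_integral_ge0.
have mwD : tree_additive mw.
  apply: add => //; rewrite integral_cst// mul1e.
  by have [_ [c c0 Dc]] := dyadic_measure (dD [::]); rewrite [X in (X < _)%E]Dc ltry.
have /andP[_ Voo] := Vf; have /andP[_ S1oo] := S1f; have /andP[_ S2oo] := S2f.
have VD : tree_additive (fun w => I v (D w)) := add _ mv v0 Voo.
have S1D : tree_additive (fun w => I sg1 (D w)) :=
  add _ (measurable_powR_comp _ mu1) sg10 S1oo.
have S2D : tree_additive (fun w => I sg2 (D w)) :=
  add _ (measurable_powR_comp _ mu2) sg20 S2oo.
have X1D : tree_additive X1 := add _ mfr fr0 X1f.
have X2D : tree_additive X2 := add _ mgr gr0 X2f.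
have J1D : tree_additive (fun w => I fq (D w)) := add _ mfq fq0 Jf.
have J2D : tree_additive (fun w => I gq (D w)) := add _ mgq gq0 Jg.
pose st := stopping mw X1 X2; pose c w := fa (mw w) (X1 w) (X2 w).
have c0 w : 0 <= c w by rewrite !mulr_ge0 ?powR_ge0.
pose A : R := 4 `^ (r1^-1 + r2^-1).
pose phi x w := (st w)%:R * c w `^ t * \1_(D w) x.
have phi0 x w : 0 <= phi x w by rewrite !mulr_ge0 ?powR_ge0.
exists (fun M x => A `^ t * \sum_(w <- descendants M [::]) phi x w); split.
- move=> M; apply: measurable_funM; first exact: measurable_cst.
  apply: measurable_sum => w; apply: measurable_funM; first exact: measurable_cst.
  exact: measurable_indic.
- by move=> M x; rewrite mulr_ge0 ?powR_ge0 ?sumr_ge0.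
- by move=> x M M' MM'; rewrite ler_wpM2l ?powR_ge0//; exact: sum_descendants_homo.
- move=> w x xw; exists (c w) => //; split.
    have [_ [e e0 De]] := dyadic_measure (dD w); have [h1 h2 _ _ _] := fin w.
    rewrite (maximal_termE e0 De (cube_integralE fr0 h1) (cube_integralE gr0 h2)).
    by rewrite /c mwE De.
  set aw := stopping_ancestor mw X1 X2 w.
  exists (size aw); apply: (@le_trans _ _ (A `^ t * phi x aw)); last first.
    by rewrite ler_wpM2l ?powR_ge0// -[in leLHS](cats0 aw); exact: le_sum_descendants.
  rewrite /phi /st stopping_stopping_ancestor mul1r indicE mem_set ?mulr1; last first.
    exact: stopping_ancestor_sub.
  rewrite -powRM ?powR_ge0//; apply: ge0_ler_powR; rewrite ?nnegrE ?(ltW t0)//.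
    by rewrite mulr_ge0 ?powR_ge0.
  exact: (fractional_average_ancestor al0 r10 r20 mw0 X10 X20 mwD w).
- move=> M; have vt0 x : 0 <= v x `^ (t / s) by exact: powR_ge0.
  have mvt := measurable_powR_comp (t / s) mv.
  pose d w := A `^ t * ((st w)%:R * c w `^ t).
  have d0 w : 0 <= d w by rewrite !mulr_ge0 ?powR_ge0.
  have mterm w : measurable_fun [set: Rn R n]
      (fun x => d w * \1_(D w) x * v x `^ (t / s)).
    apply: measurable_funM; last exact: mvt.
    by apply: measurable_funM; [exact: measurable_cst|exact: measurable_indic].
  rewrite (eq_integral (fun x => (\sum_(w <- descendants M [::])
      (d w * \1_(D w) x * v x `^ (t / s))%:E)%E)); last first.
    move=> x _; rewrite sumEFin; congr EFin; rewrite mulr_sumr mulr_suml.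
    by apply: eq_bigr => w _; rewrite /d /phi !mulrA.
  rewrite ge0_integral_sum; [|exact: mD| |]; last 2 first.
  + by move=> w; apply/measurable_EFinP/measurable_funTS; exact: mterm.
  + by move=> w x _; rewrite lee_fin !mulr_ge0 ?powR_ge0.
  apply: (@le_trans _ _ (\sum_(w <- descendants M [::]) (A `^ t * ((st w)%:R *
      (c w `^ t * (I v (D w) `^ (t / s) * mw w `^ (1 - t / s)))))%:E)%E).
    apply: lee_sum => w _; rewrite (indicator_integral _ (d0 w) mvt vt0).
    rewrite [X in (_ <= X%:E)%E](_ : _ =
      d w * (I v (D w) `^ (t / s) * mw w `^ (1 - t / s))); last first.
      by rewrite /d !mulrA.
    rewrite [X in (_ <= X)%E]EFinM; apply: lee_wpmul2l; first by rewrite lee_fin.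
    have [_ [e e0 De]] := dyadic_measure (dD w).
    have -> : mw w = e by rewrite mwE De.
    apply: (jensen_power t0 ts (mD w) e0 De mv v0).
    by have [_ []] := regular_descendant w.
  rewrite sumEFin lee_fin -mulr_sumr ler_wpM2l ?powR_ge0// -mwE.
  have XJ1 w : X1 w `^ (q1 / r1) * I sg1 (D w) `^ (1 - q1 / r1) <= I fq (D w).
    by have [_ _ h _ _] := fin w; exact: h.
  have XJ2 w : X2 w `^ (q2 / r2) * I sg2 (D w) `^ (1 - q2 / r2) <= I gq (D w).
    by have [_ _ _ h _] := fin w; exact: h.
  have m_le w : mw w <= I v (D w) `^ ((s^-1 + d1 + d2)^-1 * s^-1) *
      I sg1 (D w) `^ ((s^-1 + d1 + d2)^-1 * d1) *
      I sg2 (D w) `^ ((s^-1 + d1 + d2)^-1 * d2).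
    rewrite mwE.
    exact: (measure_le_testing s0 r10 rq1 r20 rq2 mu1 mu2 (regular_descendant w)).
  have testing w : I v (D w) `^ s^-1 * I sg1 (D w) `^ d1 * I sg2 (D w) `^ d2 <=
      K * mw w `^ (s^-1 + d1 + d2).
    by rewrite mwE; have [_ _ _ _ h] := regular_descendant w; exact: h.
  have morrey w : mw w `^ (p^-1 - q^-1) * I fq (D w) `^ q1^-1 * I gq (D w) `^ q2^-1 <= N.
    by rewrite mwE; have [_ _ _ _ h] := fin w; exact: h.
  exact: (stopping_sum_le al0 q0 qp t0 ts r10 rq1 r20 rq2 hq hs hts K0
    mw0 V0 S10 S20 X10 X20 mwD VD S1D S2D X1D X2D J1D J2D XJ1 XJ2 X1nil X2nil
    m_le testing morrey M).
Qed.

End descendants_of_a_cube.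

(** The weight in the Morrey norm, u1^(1/q1) u2^(1/q2). *)
Definition weight_factor (x : Rn R n) : R := u1 x `^ (1 / q1) * u2 x `^ (1 / q2).

Lemma weight_factorE x : weight_factor x `^ t = v x `^ (t / s).
Proof.
rewrite /weight_factor /product_weight.
have e1 : s / q1 * (t / s) = 1 / q1 * t by field; rewrite !gt_eqF.
have e2 : s / q2 * (t / s) = 1 / q2 * t by field; rewrite !gt_eqF.
rewrite powRM; [|exact: powR_ge0|exact: powR_ge0].
rewrite [RHS]powRM; [|exact: powR_ge0|exact: powR_ge0].
by rewrite -!powRrM e1 e2.
Qed.

Lemma powRN_le (a b : R) : 0 < a -> a <= b -> b `^ (- s^-1) <= a `^ (- s^-1).
Proof.
move=> a0 ab; have b0 := lt_le_trans a0 ab.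
rewrite !powRN lef_pV2 ?posrE ?powR_gt0//.
by apply: ge0_ler_powR; rewrite ?invr_ge0 ?nnegrE ?(ltW s0) ?(ltW a0) ?(ltW b0).
Qed.

(** The constant of the local estimate: 1 for the large cubes, the other
    summand for the small ones. *)
Definition cube_constant : R :=
  1 + (4 `^ (r1^-1 + r2^-1)) `^ t * testing_const q s q1 q2 r1 r2 K.

Lemma cube_constant_gt0 : 0 < cube_constant.
Proof.
apply: ltr_pwDl => //.
by rewrite mulr_ge0 ?powR_ge0 ?testing_const_ge0.
Qed.

(** The local estimate.  The dyadic cubes containing a point of Q0 are those
    containing Q0, bounded by the constant L, and the descendants of Q0,
    bounded through G; the majorants h M increase with the depth M. *)
Lemma cube_estimate (k : int) (m : 'I_n -> int) :
  (0 < \int[mu]_(x in dyadic_cube k m) (v x)%:E)%E ->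
  (\int[mu]_(x in dyadic_cube k m)
      `|maximal alpha r1 r2 f g x * (weight_factor x)%:E| `^ t <=
   (cube_constant * (K * N) `^ t *
      fine (mu (dyadic_cube k m)) `^ (1 - t / s))%:E)%E.
Proof.
have DE : @dyadic_descendant R n k m [::] = dyadic_cube k m.
  by rewrite /dyadic_descendant /= addr0.
rewrite -DE; set Q0 := dyadic_descendant k m [::] => V0.
have dQ0 : dyadic Q0 by rewrite /Q0 DE; exists k, m.
have rQ0 : regular Q0.
  exact: (dyadic_regular s0 r10 rq1 r20 rq2 mu1 mu2 u10 u20 KE dQ0 V0).
have N0 : 0 <= N := morrey_product_ge0 dQ0.
have [G [mG G0 ndG GP Gint]] := small_cubes rQ0.
have [mQ0 [Vf _ _] [c c0 Qc] upos _] := rQ0.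
have v0 := @product_weight_ge0 R n s q1 q2 u1 u2.
have mv := measurable_product_weight s q1 q2 mu1 mu2.
have [IV0 IVE] := fin_integral_pos v0 Vf.
have vt0 x : 0 <= v x `^ (t / s) by exact: powR_ge0.
have mvt := measurable_powR_comp (t / s) mv.
set L := K * N * I v Q0 `^ (- s^-1).
have L0 : 0 <= L by rewrite !mulr_ge0 ?powR_ge0.
pose h M x := ((L `^ t + G M x) * v x `^ (t / s))%:E.
have hsup M x (a : R) : a `^ t <= L `^ t + G M x ->
    ((a `^ t * weight_factor x `^ t)%:E <= ereal_sup (range (h^~ x)))%E.
  move=> aG; apply: (@le_trans _ _ (h M x)); last by apply: ereal_sup_ubound; exists M.
  by rewrite weight_factorE lee_fin ler_wpM2r.
have h0 M x : (0 <= h M x)%E by rewrite lee_fin mulr_ge0 ?addr_ge0 ?powR_ge0.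
apply: (@le_trans _ _ (\int[mu]_(x in Q0) ereal_sup (range (h^~ x)))%E).
  apply: ge0_le_integral_nonmeasurable => x Q0x; first exact: poweR_ge0.
  apply: ereal_sup_powR_bound => //.
  - by rewrite mulr_ge0 ?powR_ge0.
  - exists (maximal_term Q0); last exact: maximal_term_ge0.
    by exists Q0.
  - by apply: le_trans (h0 0%N x) _; apply: ereal_sup_ubound; exists 0%N.
  move=> y [Q [dQ Qx] <-]; rewrite -/(maximal_term Q).
  have Q0x' : dyadic_cube k m x by rewrite -DE.
  have [Q0Q|[w Qw]] := dyadic_nested dQ Qx Q0x'.
    exists L => //; split; last by apply: (hsup 0%N); rewrite lerDl.
    have mQ := (dyadic_measure dQ).1.
    have VQ : (\int[mu]_(x in Q0) (v x)%:E <= \int[mu]_(x in Q) (v x)%:E)%E.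
      apply: ge0_subset_integral; [exact: mQ0|exact: mQ| | |].
      - by apply/measurable_EFinP; exact: measurable_funTS.
      - by move=> z _; rewrite lee_fin.
      - by rewrite /Q0 DE.
    have rQ : regular Q.
      apply: (dyadic_regular s0 r10 rq1 r20 rq2 mu1 mu2 u10 u20 KE dQ).
      exact: lt_le_trans V0 VQ.
    apply: (le_trans (large_cube_term dQ rQ)); rewrite lee_fin /L.
    have [_ [VQf _ _] _ _ _] := rQ; have [IQ0 IQE] := fin_integral_pos v0 VQf.
    have IVQ : I v Q0 <= I v Q by move: VQ; rewrite IVE IQE lee_fin.
    exact: (ler_wpM2l (mulr_ge0 K0 N0) (powRN_le IV0 IVQ)).
  rewrite Qw in Qx *; have [a a0 [ya [M aM]]] := GP w x Qx.
  exists a => //; split=> //; apply: (hsup M); apply: (le_trans aM).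
  by rewrite lerDr powR_ge0.
have mh M : measurable_fun [set: Rn R n] (h M).
  apply/measurable_EFinP; apply: measurable_funM; last exact: mvt.
  by apply: measurable_funD; [exact: measurable_cst|exact: mG].
apply: nondecreasing_integral_bound.
- exact: mQ0.
- by move=> M; apply: measurable_funTS; exact: mh.
- by move=> M x _; exact: h0.
- move=> x _ M M' MM'; rewrite lee_fin ler_wpM2r// lerD2l.
  exact: ndG.
move=> M.
have jensen := jensen_power t0 ts mQ0 c0 Qc mv v0 Vf.
have := Gint M; rewrite [fine _](_ : _ = c); last by rewrite -/Q0 Qc.
move=> GM.
rewrite /h.
rewrite (eq_integral (fun x => ((L `^ t)%:E * (v x `^ (t / s))%:E +
    (G M x * v x `^ (t / s))%:E)%E)); last first.
  by move=> x _; rewrite -EFinM -EFinD mulrDl.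
rewrite ge0_integralD; [|exact: mQ0| | | |]; last 4 first.
- by move=> x _; rewrite -EFinM lee_fin mulr_ge0 ?powR_ge0.
- apply: measurable_funTS; apply/measurable_EFinP.
  by apply: measurable_funM; [exact: measurable_cst|exact: mvt].
- by move=> x _; rewrite lee_fin mulr_ge0.
- apply: measurable_funTS; apply/measurable_EFinP.
  by apply: measurable_funM; [exact: mG|exact: mvt].
rewrite ge0_integralZl_EFin; [|exact: mQ0| | |exact: powR_ge0]; last 2 first.
- by move=> x _; rewrite lee_fin.
- by apply: measurable_funTS; exact/measurable_EFinP.
have Lt0 : (0 <= (L `^ t)%:E)%E by rewrite lee_fin powR_ge0.
apply: (le_trans (leeD (lee_wpmul2l Lt0 jensen) GM)).
rewrite -EFinM -EFinD lee_fin le_eqVlt; apply/orP; left; apply/eqP.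
have LV : L `^ t * I v Q0 `^ (t / s) = (K * N) `^ t.
  rewrite /L powRM; [|exact: mulr_ge0|exact: powR_ge0].
  rewrite -powRrM -mulrA.
  rewrite -powRD ?(gt_eqF IV0) ?implybT//.
  by rewrite (_ : _ + _ = 0) ?powRr0 ?mulr1// mulNr mulrC addrC subrr.
by rewrite [X in X + _ = _]mulrA LV /cube_constant; ring.
Qed.

End local_estimate.

(** * The Morrey norm of the maximal operator *)

Theorem theorem2p9 (R : realType) (n : nat)
    (alpha p q t s q1 q2 r1 r2 : R) (u1 u2 : Rn R n -> R)
    (hu1 : weight u1) (hu2 : weight u2)
    (halpha : 0 <= alpha < n%:R)
    (hq : 0 < q) (hqp : q <= p) (ht : 0 < t) (hts : t <= s)
    (hr1 : 0 < r1) (hr1q1 : r1 < q1) (hr2 : 0 < r2) (hr2q2 : r2 < q2)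
    (hq12 : 1 / q = 1 / q1 + 1 / q2)
    (hs : 1 / s = 1 / p - alpha / n%:R) (hts_qp : t / s = q / p)
    (hu : (weight_const s q1 q2 r1 r2 u1 u2 < +oo)%E) :
  exists C : R, 0 < C /\
    forall f g : Rn R n -> R,
      measurable_fun [set: Rn R n] f -> measurable_fun [set: Rn R n] g ->
      (morrey_norm t s (fun x => maximal alpha r1 r2 f g x
                                 * (u1 x `^ (1 / q1))%:E
                                 * (u2 x `^ (1 / q2))%:E)
       <= C%:E * weight_const s q1 q2 r1 r2 u1 u2
          * weighted_morrey_product p q1 q2 u1 u2 f g)%E.
Proof.
have [mu1 u10 _] := hu1; have [mu2 u20 _] := hu2.
have al0 : 0 <= alpha / n%:R by case/andP: halpha => a0 _; rewrite divr_ge0.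
have s0 : 0 < s := lt_le_trans ht hts.
rewrite !div1r in hq12 hs.
have dQ1 : dyadic (@dyadic_cube R n 0 (fun=> 0)) by exists 0, (fun=> 0).
have W0 : (0 <= weight_const s q1 q2 r1 r2 u1 u2)%E.
  apply: le_trans (ereal_sup_ubound _); last by exists (dyadic_cube 0 (fun=> 0)).
  by rewrite !mule_ge0 ?poweR_ge0.
set K := fine (weight_const s q1 q2 r1 r2 u1 u2).
have K0 : 0 <= K by exact: fine_ge0.
have KE : weight_const s q1 q2 r1 r2 u1 u2 = K%:E by rewrite fineK// ge0_fin_numE.
set A := cube_constant q t s q1 q2 r1 r2 K.
have A0 : 0 < A := cube_constant_gt0 t s K hq hr1 hr1q1 hr2 hr2q2.
exists (A `^ t^-1); split; first by rewrite powR_gt0.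
move=> f g mf mg.
have P0 : (0 <= weighted_morrey_product p q1 q2 u1 u2 f g)%E.
  apply: le_trans (ereal_sup_ubound _); last by exists (dyadic_cube 0 (fun=> 0)).
  by rewrite !mule_ge0 ?poweR_ge0.
have RHS0 : (0 <= (A `^ t^-1)%:E * K%:E * weighted_morrey_product p q1 q2 u1 u2 f g)%E.
  by rewrite !mule_ge0// lee_fin powR_ge0.
rewrite KE.
apply: ge_ereal_sup => _ [Q [k [m QE]] <-]; rewrite QE {Q QE}.
have [mQ Qvol] := @lebesgue_dyadic_cube R n k m.
set Q := dyadic_cube k m in mQ Qvol *.
have dQ : dyadic Q by exists k, m.
set c := ((2 : R) ^ (- k)) ^+ n in Qvol.
have c0 : 0 < c by rewrite exprn_gt0// exprz_gt0.
set h := (fun x => `|_| `^ t)%E.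
have hE x : h x = (`|maximal alpha r1 r2 f g x
    * (weight_factor q1 q2 u1 u2 x)%:E| `^ t)%E.
  by rewrite /h -muleA -EFinM.
have h0 x : (0 <= h x)%E by exact: poweR_ge0.
have v0 x : (0 <= (product_weight s q1 q2 u1 u2 x)%:E)%E.
  by rewrite lee_fin product_weight_ge0.
have mv : measurable_fun [set: Rn R n] (fun x => (product_weight s q1 q2 u1 u2 x)%:E).
  by apply/measurable_EFinP; exact: measurable_product_weight.
have Vge0 : (0 <= \int[lebesgue]_(x in Q) (product_weight s q1 q2 u1 u2 x)%:E)%E.
  by apply: integral_ge0 => x _; exact: v0.
have [V0|Vn0] := eqVneq
  (\int[lebesgue]_(x in Q) (product_weight s q1 q2 u1 u2 x)%:E)%E 0%E.
  (* the weight vanishes almost everywhere on Q, and so does the function h *)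
  have hint : (\int[lebesgue]_(x in Q) h x <= 0%:E)%E.
    apply: (@le_trans _ _ (\int[lebesgue]_(x in Q)
        (+oo * (product_weight s q1 q2 u1 u2 x)%:E))%E).
      apply: ge0_le_integral_nonmeasurable => x _; first exact: h0.
      have := v0 x; rewrite le_eqVlt => /predU1P[vx|vx].
        rewrite hE -vx mule0; have -> : weight_factor q1 q2 u1 u2 x = 0.
          apply: (@powR_eq0_eq0 _ _ t).
          rewrite (weight_factorE u1 u2 ht hts hr1 hr1q1 hr2 hr2q2).
          by move: vx => [<-]; rewrite powR0 ?gt_eqF ?divr_gt0.
        by rewrite mule0 abse0 poweR0r ?gt_eqF.
      by rewrite gt0_mulye// leey.
    have mQv := measurable_funTS (D := Q) mv.
    have ae0 := integral_eq0_ae mQ mQv (fun x _ => v0 x) V0.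
    rewrite le_eqVlt; apply/orP; left; apply/eqP.
    apply: etrans (integral0 lebesgue Q).
    apply: ge0_ae_eq_integral; [exact: mQ| |exact: measurable_cst| |by []|].
    - by apply: emeasurable_funM; [exact: measurable_cst|exact: mQv].
    - by move=> x _; rewrite mule_ge0// leey.
    - by apply: filterS ae0 => x vx Qx; rewrite (vx Qx) mule0.
  apply: (le_trans (morrey_term_le s c0 Qvol ht h0 hint)).
  by rewrite mulr0 powR0 ?gt_eqF ?invr_gt0// mulr0.
have V0 : (0 < \int[lebesgue]_(x in Q) (product_weight s q1 q2 u1 u2 x)%:E)%E.
  by rewrite lt_neqAle eq_sym Vn0.
have rQ := dyadic_regular s0 hr1 hr1q1 hr2 hr2q2 mu1 mu2 u10 u20 KE dQ V0.
(* if the Morrey quantity is infinite, so is the right-hand side, as K > 0 *)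
have Kpos : 0 < K.
  have [_ [Vf S1f S2f] _ _ testing] := rQ.
  have [V1 _] := fin_integral_pos (@product_weight_ge0 R n s q1 q2 u1 u2) Vf.
  have [S11 _] := fin_integral_pos (fun x => powR_ge0 _ _) S1f.
  have [S21 _] := fin_integral_pos (fun x => powR_ge0 _ _) S2f.
  rewrite lt_neqAle K0 andbT; apply/negP => /eqP KE0; move: testing.
  rewrite -KE0 mul0r leNgt => /negP; apply.
  exact: mulr_gt0 (mulr_gt0 (powR_gt0 _ V1) (powR_gt0 _ S11)) (powR_gt0 _ S21).
have [->|Pfin] := eqVneq (weighted_morrey_product p q1 q2 u1 u2 f g) +oo%E.
  by rewrite gt0_muley ?leey// -EFinM lte_fin mulr_gt0 ?powR_gt0.
set N := fine (weighted_morrey_product p q1 q2 u1 u2 f g).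
have NE : weighted_morrey_product p q1 q2 u1 u2 f g = N%:E.
  by rewrite fineK// ge0_fin_numE// ltey.
have N0 : 0 <= N by exact: fine_ge0.
have est := cube_estimate al0 hq hqp ht hts hr1 hr1q1 hr2 hr2q2 hq12 hs hts_qp
  mu1 mu2 u10 u20 mf mg KE K0 NE V0.
rewrite [fine _](_ : _ = c) in est; last by rewrite -/Q Qvol.
have hint : (\int[lebesgue]_(x in Q) h x <= (A * (K * N) `^ t * c `^ (1 - t / s))%:E)%E.
  by rewrite (eq_integral (fun x => (`|maximal alpha r1 r2 f g x *
    (weight_factor q1 q2 u1 u2 x)%:E| `^ t)%E))// => x _; exact: hE.
apply: (le_trans (morrey_term_le s c0 Qvol ht h0 hint)).
rewrite morrey_normalization ?(ltW A0) ?mulr_ge0// NE -!EFinM lee_fin mulrA.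
exact: lexx.
Qed.
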